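(* For every normalized Horn CNF $\Gamma$ on a finite variable set $X$, the hypergraph $\mathcal C(\Gamma)$ on the ground set $U_\Gamma$ described in the context can be constructed in $O(\|\Gamma\|_{\mathrm{inc}})$ time; it is normalized and satisfies $\operatorname{rank}(\mathcal C(\Gamma))\le 3$ and $L(\mathcal C(\Gamma))=O(\|\Gamma\|_{\mathrm{inc}})$. The maps $$\eta_\Gamma:\operatorname{False}(\Gamma)\longrightarrow \operatorname{Stop}(\mathcal C(\Gamma))\setminus\{\varnothing\}$$ and $$\widehat\eta_\Gamma:\operatorname{Mod}(\Gamma)\longrightarrow \operatorname{Mod}(\Phi_{\mathcal C(\Gamma)})\setminus\{U_\Gamma\},\qquad \widehat\eta_\Gamma(M)=U_\Gamma\setminus\eta_\Gamma(X\setminus M),$$ are inclusion-order isomorphisms. For each model $M\models\Gamma$, the proper target model $\widehat\eta_\Gamma(M)$ is the unique proper model $K\neq U_\Gamma$ of $\Phi_{\mathcal C(\Gamma)}$ satisfying $K\cap X=M$; hence every coordinate in $U_\Gamma\setminus X$ is uniquely determined by $M$. The inverse of $\eta_\Gamma$ is $T\mapsto T\cap X$, and the inverse of $\widehat\eta_\Gamma$ is $K\mapsto K\cap X$. In particular, the inclusion-maximal models of $\Gamma$ correspond bijectively (via $\widehat\eta_\Gamma$) to the coatoms of the closure system $\operatorname{Mod}(\Phi_{\mathcal C(\Gamma)})$. For bit-vector representations, the forward and inverse maps can be evaluated in $O(\|\Gamma\|_{\mathrm{inc}})$ time per output.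
   Context: Horn CNFs. Let $X$ be a finite set of Boolean variables; a truth assignment is identified with the set $M\subseteq X$ of variables assigned true. A Horn clause is either a definite implication $A\to b$ with $A\subseteq X$, $b\in X\setminus A$, or a negative implication $A\to\bot$ with $A\subseteq X$; the premise $A$ may be empty. $M$ satisfies $A\to b$ if $A\subseteq M$ implies $b\in M$, and satisfies $A\to\bot$ if $A\nsubseteq M$. A Horn CNF $\Gamma$ is a finite conjunction of Horn clauses; it is normalized if premises are sets and there are no duplicate clauses. $\operatorname{Mod}(\Gamma)=\{M\subseteq X: M\models\Gamma\}$ is the set of its models, and $\operatorname{False}(\Gamma)=\{X\setminus M: M\models\Gamma\}$. Its incidence length is $$\|\Gamma\|_{\mathrm{inc}}=|X|+|\Gamma|+\sum_{A\to b\in\Gamma}(|A|+1)+\sum_{A\to\bot\in\Gamma}|A|.$$ Hypergraphs. A hypergraph on a finite set $V$ is a family $\mathcal H\subseteq 2^V$, given by its incidence list; it is normalized if it has no repeated incidences, no duplicate hyperedges and no empty hyperedge. Put $L(\mathcal H)=|V|+|\mathcal H|+\sum_{A\in\mathcal H}|A|$ and $\operatorname{rank}(\mathcal H)=\max_{A\in\mathcal H}|A|$ (zero if $\mathcal H$ is empty). Define the definite Horn CNF $$\Phi_{\mathcal H}=\bigwedge_{A\in\mathcal H}\bigwedge_{v\in A}\bigl((A\setminus\{v\})\to v\bigr).$$ $\operatorname{Mod}(\Phi_{\mathcal H})$ is a closure system on $V$; its coatoms are the inclusion-maximal members of $\operatorname{Mod}(\Phi_{\mathcal H})\setminus\{V\}$.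 A proper model is a model different from $V$. A set $S\subseteq V$ is a stopping set of $\mathcal H$ if $|A\cap S|\neq 1$ for every $A\in\mathcal H$; $\operatorname{Stop}(\mathcal H)$ is the family of all stopping sets. Families of sets are ordered by inclusion. Construction of $\mathcal C(\Gamma)$. All elements called new below are distinct from each other and from the elements of $X$. (1) Each $x\in X$ is an element of the ground set. (2) For each clause $C$ with premise $A_C=\{a_1,\dots,a_k\}$ (in an arbitrary fixed order), define an output element $o_C$: if $k=0$, $o_C$ is a new element and the singleton hyperedge $\{o_C\}$ is added; if $k=1$, $o_C=a_1$ and nothing is added; if $k\ge 2$, introduce new elements $o_2,\dots,o_k,q_2,\dots,q_k$ (specific to $C$), add the hyperedges $\{o_2,q_2\},\{a_1,a_2,o_2\},\{a_1,o_2,q_2\}$, and for each $3\le i\le k$ add $\{o_i,q_i\},\{o_{i-1},a_i,o_i\},\{o_{i-1},o_i,q_i\}$; put $o_C=o_k$. (3) For each definite clause $C=(A_C\to b_C)$, introduce a new element $q_C$ and add the hyperedges $\{o_C,q_C\}$ and $\{b_C,o_C,q_C\}$. (4) Introduce new elements $r,\rho$; add $\{r,\rho\}$ and, for every $x\in X$, $\{x,r,\rho\}$. (5) For each negative clause $C=(A_C\to\bot)$, add $\{o_C,r\}$. $U_\Gamma$ is the set of all elements so introduced (including $X$). The map $\eta_\Gamma$. For $S\subseteq X$, $\eta_\Gamma(S)\subseteq U_\Gamma$ is defined by: $\eta_\Gamma(S)\cap X=S$; for each clause $C$ with $k=0$, $o_C\notin\eta_\Gamma(S)$; for each clause $C$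 with $k\ge2$ and each $2\le i\le k$, both $o_i$ and $q_i$ belong to $\eta_\Gamma(S)$ if $\{a_1,\dots,a_i\}\cap S\ne\varnothing$ and neither belongs to it otherwise; for each definite clause $C$, $q_C\in\eta_\Gamma(S)$ iff $o_C\in\eta_\Gamma(S)$; and $r,\rho\in\eta_\Gamma(S)$. *)

(* Defs.v *)
From HB Require Import structures.
From mathcomp Require Import all_boot.
From mathcomp Require Import finmap.

Set Implicit Arguments.
Unset Strict Implicit.
Unset Printing Implicit Defensive.

Local Open Scope fset_scope.

(* ---------------------------- Horn CNFs ---------------------------------- *)

(* [Clause A (Some b)] is A -> b and [Clause A None] is A -> bottom.  The order
   of the list A is the arbitrary fixed order of the premise that the
   construction below depends on. *)
Record clause (T : Type) := Clause { prem : seq T; concl : option T }.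

Definition cnf (T : Type) := seq (clause T).

Definition horn_clause (T : choiceType) (X : {fset T}) (C : clause T) : bool :=
  all (mem X) (prem C) &&
  (if concl C is Some b then (b \in X) && (b \notin prem C) else true).

Definition horn_cnf (T : choiceType) (X : {fset T}) (G : cnf T) : bool :=
  all (horn_clause X) G.

Definition normalized_cnf (T : choiceType) (G : cnf T) : bool :=
  all (fun C => uniq (prem C)) G &&
  uniq [seq ([fset x in prem C], concl C) | C <- G].

Definition sat (T : choiceType) (M : {fset T}) (C : clause T) : bool :=
  all (mem M) (prem C) ==> (if concl C is Some b then b \in M else false).

Definition Mod (T : choiceType) (X : {fset T}) (G : cnf T) : {fset {fset T}} :=
  [fset M in fpowerset X | all (sat M) G].

Definition False_ (T : choiceType) (X : {fset T}) (G : cnf T) :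
    {fset {fset T}} :=
  [fset X `\` M | M in Mod X G].

Definition inc_length (T : choiceType) (X : {fset T}) (G : cnf T) : nat :=
  #|` X| + size G
  + \sum_(C <- G | isSome (concl C)) (size (prem C) + 1)
  + \sum_(C <- G | ~~ isSome (concl C)) size (prem C).

(* --------------------------- Hypergraphs --------------------------------- *)

(* A hypergraph is given by its incidence list H, the list of its hyperedges,
   each one being the list of its elements. *)
Definition hypergraph_on (T : choiceType) (V : {fset T}) (H : seq (seq T)) :=
  all (all (mem V)) H.

Definition normalized_hypergraph (T : choiceType) (H : seq (seq T)) : bool :=
  [&& all uniq H, uniq [seq [fset v in A] | A <- H] & [::] \notin H].

Definition hlength (T : choiceType) (V : {fset T}) (H : seq (seq T)) : nat :=
  #|` V| + size H + \sum_(A <- H) size A.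

Definition hrank (T : choiceType) (H : seq (seq T)) : nat :=
  \max_(A <- H) size A.

Definition Phi (T : choiceType) (H : seq (seq T)) : cnf T :=
  [seq Clause [seq u <- A | u != v] (Some v) | A <- H, v <- A].

Definition Stop (T : choiceType) (V : {fset T}) (H : seq (seq T)) :
    {fset {fset T}} :=
  [fset S in fpowerset V | all (fun A => #|` [fset v in A] `&` S| != 1) H].

Definition proper_models (T : choiceType) (V : {fset T}) (H : seq (seq T)) :
    {fset {fset T}} :=
  Mod V (Phi H) `\ V.

Definition incl_max (T : choiceType) (F : {fset {fset T}}) : {fset {fset T}} :=
  [fset M in F | all (fun N => (M `<=` N) ==> (N == M)) F].

Definition coatoms (T : choiceType) (V : {fset T}) (H : seq (seq T)) :
    {fset {fset T}} :=
  incl_max (proper_models V H).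

(* f is an isomorphism for inclusion from F onto F', with inverse g. *)
Definition incl_iso (T T' : choiceType)
    (F : {fset {fset T}}) (F' : {fset {fset T'}})
    (f : {fset T} -> {fset T'}) (g : {fset T'} -> {fset T}) : Prop :=
  [/\ {in F, forall S, f S \in F'},
      {in F', forall S, g S \in F},
      {in F, cancel f g},
      {in F', cancel g f} &
      {in F &, forall S S', (f S `<=` f S') = (S `<=` S')}].

Definition bij_between (T T' : choiceType)
    (F : {fset {fset T}}) (F' : {fset {fset T'}})
    (f : {fset T} -> {fset T'}) : Prop :=
  [/\ {in F, forall S, f S \in F'},
      {in F &, injective f} &
      {in F', forall S', exists2 S, S \in F & S' = f S}].

(* ----------------------- The construction C(Gamma) ----------------------- *)

(* Names of the elements of U_Gamma.  The index c is the position of a clause C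
   in the list Gamma; [Oelt c i] and [Qelt c i] are the elements o_i and q_i
   (2 <= i <= k) specific to C, [Oelt c 0] is the new element o_C when k = 0,
   [QCelt c] is q_C, and [Relt], [Rhoelt] are r and rho. *)
Inductive elt (T : Type) :=
| Var of T
| Oelt of nat & nat
| Qelt of nat & nat
| QCelt of nat
| Relt
| Rhoelt.

Arguments Oelt {T} c i.
Arguments Qelt {T} c i.
Arguments QCelt {T} c.
Arguments Relt {T}.
Arguments Rhoelt {T}.

Definition elt_code (T : Type) (u : elt T) :
    T + (bool * nat * nat) + (nat + bool) :=
  match u with
  | Var x => inl (inl x)
  | Oelt c i => inl (inr (true, c, i))
  | Qelt c i => inl (inr (false, c, i))
  | QCelt c => inr (inl c)
  | Relt => inr (inr true)
  | Rhoelt => inr (inr false)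
  end.

Definition elt_decode (T : Type) (v : T + (bool * nat * nat) + (nat + bool)) :
    elt T :=
  match v with
  | inl (inl x) => Var x
  | inl (inr (b, c, i)) => if b then Oelt c i else Qelt c i
  | inr (inl c) => QCelt c
  | inr (inr b) => if b then Relt else Rhoelt
  end.

Lemma elt_codeK (T : Type) : cancel (@elt_code T) (@elt_decode T).
Proof. by case. Qed.

HB.instance Definition _ (T : choiceType) :=
  Choice.copy (elt T) (can_type (@elt_codeK T)).

Definition indexed (A : Type) (s : seq A) : seq (nat * A) :=
  zip (iota 0 (size s)) s.

Definition output_elt (T : Type) (c : nat) (C : clause T) : elt T :=
  match prem C with
  | [::] => Oelt c 0
  | [:: a] => Var a
  | _ => Oelt c (size (prem C))
  end.

(* The hyperedges for a_i, a_(i+1), ..., a_k listed in A, where [prev] is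
   o_(i-1) if i > 2, and a_1 if i = 2. *)
Fixpoint chain_edges (T : Type) (c : nat) (prev : elt T) (i : nat) (A : seq T) :
    seq (seq (elt T)) :=
  match A with
  | [::] => [::]
  | a :: A' =>
      [:: [:: Oelt c i; Qelt c i];
          [:: prev; Var a; Oelt c i];
          [:: prev; Oelt c i; Qelt c i]] ++ chain_edges c (Oelt c i) i.+1 A'
  end.

Definition clause_edges (T : Type) (c : nat) (C : clause T) :
    seq (seq (elt T)) :=
  match prem C with
  | [::] => [:: [:: Oelt c 0]]
  | a :: A => chain_edges c (Var a) 2 A
  end ++
  match concl C with
  | Some b => [:: [:: output_elt c C; QCelt c];
                  [:: Var b; output_elt c C; QCelt c]]
  | None => [:: [:: output_elt c C; Relt]]
  end.

Definition clause_elts (T : Type) (c : nat) (C : clause T) : seq (elt T) :=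
  match prem C with
  | [::] => [:: Oelt c 0]
  | _ :: A => flatten [seq [:: Oelt c i; Qelt c i] | i <- iota 2 (size A)]
  end ++
  (if concl C is Some _ then [:: QCelt c] else [::]).

(* The elements of U_Gamma; the position of an element in this list is its
   number in the machine encodings below. *)
Definition elts (T : choiceType) (X : {fset T}) (G : cnf T) : seq (elt T) :=
  [seq Var x | x <- enum_fset X] ++ [:: Relt; Rhoelt] ++
  flatten [seq clause_elts cC.1 cC.2 | cC <- indexed G].

Definition U (T : choiceType) (X : {fset T}) (G : cnf T) : {fset elt T} :=
  [fset u in elts X G].

Definition construction (T : choiceType) (X : {fset T}) (G : cnf T) :
    seq (seq (elt T)) :=
  [:: Relt; Rhoelt] :: [seq [:: Var x; Relt; Rhoelt] | x <- enum_fset X] ++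
  flatten [seq clause_edges cC.1 cC.2 | cC <- indexed G].

(* Membership in eta_Gamma(S) of all elements except the q_C.  Since
   [take 0 _] is empty, o_C is out when k = 0. *)
Definition in_eta0 (T : choiceType) (G : cnf T) (S : {fset T}) (u : elt T) :
    bool :=
  match u with
  | Var x => x \in S
  | Oelt c i | Qelt c i =>
      has (mem S) (take i (prem (nth (Clause [::] None) G c)))
  | QCelt _ => false
  | Relt | Rhoelt => true
  end.

Definition in_eta (T : choiceType) (G : cnf T) (S : {fset T}) (u : elt T) :
    bool :=
  if u is QCelt c then in_eta0 G S (output_elt c (nth (Clause [::] None) G c))
  else in_eta0 G S u.

Definition eta_map (T : choiceType) (X : {fset T}) (G : cnf T) (S : {fset T}) :
    {fset elt T} :=
  [fset u in U X G | in_eta G S u].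

Definition etahat_map (T : choiceType) (X : {fset T}) (G : cnf T) (M : {fset T}) :
    {fset elt T} :=
  U X G `\` eta_map X G (X `\` M).

(* W |-> W :&: X, read as a subset of X. *)
Definition trace (T : choiceType) (X : {fset T}) (W : {fset elt T}) :
    {fset T} :=
  [fset x in X | Var x \in W].

(* --------------------------- Model of computation ------------------------ *)

(* Programs of a random access machine with unit cost: registers and arrays of
   natural numbers, a read-only input stream and a write-only output stream.
   The only arithmetic is successor and predecessor, so that no number ever
   exceeds the largest constant or input number plus the running time: a
   computation in time t on numbers at most t uses words of O(log t) bits, and
   a time bound here yields the same bound, up to a constant factor, on the
   usual RAM and word-RAM. *)
Inductive com :=
| CSkip
| CConst (x n : nat)       (* x := n *)
| CCopy (x y : nat)        (* x := y *)
| CSucc (x : nat)          (* x := x + 1 *)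
| CPred (x : nat)          (* x := x - 1 *)
| CLoad (x a y : nat)      (* x := a[y] *)
| CStore (a x y : nat)     (* a[x] := y *)
| CRead (x : nat)          (* x := next input, or 0 if there is none *)
| CWrite (x : nat)         (* append x to the output *)
| CSeq (p q : com)
| CIf (x : nat) (p q : com)  (* if x <> 0 then p else q *)
| CWhile (x : nat) (p : com). (* while x <> 0 do p *)

Record state := State {
  reg : nat -> nat;
  arr : nat -> nat -> nat;
  inp : seq nat;
  out : seq nat
}.

Definition init (i : seq nat) : state :=
  State (fun=> 0) (fun _ _ => 0) i [::].

Definition set_reg (s : state) (x v : nat) : state :=
  State [eta reg s with x |-> v] (arr s) (inp s) (out s).

Definition set_arr (s : state) (a i v : nat) : state :=
  State (reg s) (fun b j => if (b == a) && (j == i) then v else arr s b j)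
        (inp s) (out s).

(* [exec p s t s']: started in s, the program p halts in s' after t steps. *)
Inductive exec : com -> state -> nat -> state -> Prop :=
| ESkip s : exec CSkip s 1 s
| EConst s x n : exec (CConst x n) s 1 (set_reg s x n)
| ECopy s x y : exec (CCopy x y) s 1 (set_reg s x (reg s y))
| ESucc s x : exec (CSucc x) s 1 (set_reg s x (reg s x).+1)
| EPred s x : exec (CPred x) s 1 (set_reg s x (reg s x).-1)
| ELoad s x a y : exec (CLoad x a y) s 1 (set_reg s x (arr s a (reg s y)))
| EStore s a x y : exec (CStore a x y) s 1 (set_arr s a (reg s x) (reg s y))
| ERead s x :
    exec (CRead x) s 1
      (set_reg (State (reg s) (arr s) (behead (inp s)) (out s))
               x (head 0 (inp s)))
| EWrite s x :
    exec (CWrite x) s 1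
      (State (reg s) (arr s) (inp s) (rcons (out s) (reg s x)))
| ESeq p q s s' s'' t t' :
    exec p s t s' -> exec q s' t' s'' -> exec (CSeq p q) s (t + t') s''
| EIfTrue x p q s s' t :
    reg s x != 0 -> exec p s t s' -> exec (CIf x p q) s t.+1 s'
| EIfFalse x p q s s' t :
    reg s x = 0 -> exec q s t s' -> exec (CIf x p q) s t.+1 s'
| EWhileTrue x p s s' s'' t t' :
    reg s x != 0 -> exec p s t s' -> exec (CWhile x p) s' t' s'' ->
    exec (CWhile x p) s (t + t').+1 s''
| EWhileFalse x p s :
    reg s x = 0 -> exec (CWhile x p) s 1 s.

Definition computes (p : com) (i o : seq nat) (t : nat) : Prop :=
  exists s t', [/\ exec p (init i) t' s, out s = o & t' <= t].

(* Encodings.  Elements of a ground set are numbered by their position in a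
   list of its elements. *)
Definition encode_clause (T : choiceType) (X : {fset T}) (C : clause T) :
    seq nat :=
  size (prem C) :: [seq index x (enum_fset X) | x <- prem C] ++
  (if concl C is Some b then [:: 1; index b (enum_fset X)] else [:: 0]).

Definition encode_cnf (T : choiceType) (X : {fset T}) (G : cnf T) : seq nat :=
  [:: #|` X|, size G & flatten [seq encode_clause X C | C <- G]].

Definition encode_hypergraph (T : choiceType) (vs : seq T) (H : seq (seq T)) :
    seq nat :=
  [:: size vs, size H &
     flatten [seq size A :: [seq index v vs | v <- A] | A <- H]].

Definition bits (T : choiceType) (vs : seq T) (S : {fset T}) : seq nat :=
  [seq nat_of_bool (v \in S) | v <- vs].

(* Main.v *)
Require Import Defs.
From HB Require Import structures.
From mathcomp Require Import all_boot.
From mathcomp Require Import finmap zify.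
From Stdlib Require Import FunctionalExtensionality.
Import Defs.

Set Implicit Arguments.
Unset Strict Implicit.
Unset Printing Implicit Defensive.

(** In a stopping set, the hyperedge [{o, q}] makes [o] and [q] agree, and for
    agreeing [o] and [q] the hyperedges [{u, v, o}] and [{u, o, q}] say that [o]
    is the disjunction of [u] and [v] ([chain_stops]).  Reading the members of [X]
    in the set as the false variables, [o_C] thus says that some premise variable
    of [C] is false, the hyperedges [{o_C, q_C}] and [{b, o_C, q_C}] that this is
    so whenever [b] is false, and [{o_C, r}] that this is so if [r] is present
    ([clause_stops]).  If [r] is absent, then [{r, rho}] and [{x, r, rho}] remove
    all variables and with them everything else; so a nonempty stopping set
    contains [r], is determined by its trace on [X], and this trace is the set of
    false variables of a model ([stop_trace]).  Conversely all hyperedges are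
    respected by the image of such a set ([eta_stops]).  Since disjunctions are
    monotone, this is an isomorphism for inclusion ([eta_iso]).

    A set is a model of [Phi H] exactly when its complement is a stopping set
    ([sat_Phi]).  Taking complements on both sides gives the isomorphism of the
    models ([etahat_iso]), and an isomorphism preserves maximal elements
    ([incl_iso_max]).

    Hyperedges of different clauses are different sets because they contain
    elements of their clauses; the exceptions [{a, r}] come from the clauses
    [a -> bot], which are not repeated ([construction_distinct]).

    The programs read the clauses once into an array, with a counter for each of
    the two sizes that have to be written first, and then pass over the array.
    As elements are numbered in the order of their creation, the hyperedges are
    written with one further counter ([runs_build]), and the bits of the gates
    with one accumulator ([runs_forward]).  Each pass takes a bounded number of
    steps per entry of the input. *)

(** * Executing programs *)

(** Machine states with finitely many nonzero cells.  Lists make the effect of a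
    program on given registers computable, and states reached in different ways
    equal by computation. *)
Record cfg := Cfg {
  regs : seq nat; arrs : seq (seq nat); input : seq nat; output : seq nat }.

Definition state_of (c : cfg) : state :=
  State (nth 0 (regs c)) (fun a => nth 0 (nth [::] (arrs c) a))
        (input c) (output c).

(** Both lists may be padded at will, since absent cells hold 0. *)
Lemma init_cfg i k : init i = state_of (Cfg (nseq k 0) [:: [::]; [::]] i [::]).
Proof.
rewrite /init /state_of /=; congr State.
  by apply: functional_extensionality => x; rewrite nth_nseq if_same.
apply: functional_extensionality => a; apply: functional_extensionality => x.
by case: a => [|[|a]]; rewrite /= ?nth_nil.
Qed.

Fixpoint straight (p : com) : bool :=
  match p with
  | CSeq p q | CIf _ p q => straight p && straight q
  | CWhile _ _ => false
  | _ => true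
  end.

(** Both branches of a test are counted: only an upper bound is wanted. *)
Fixpoint steps (p : com) : nat :=
  match p with
  | CSeq p q => steps p + steps q
  | CIf _ p q => (steps p + steps q).+1
  | _ => 1
  end.

Fixpoint eval (p : com) (c : cfg) : cfg :=
  let: Cfg rs ars i o := c in
  match p with
  | CSkip | CWhile _ _ => c
  | CConst x n => Cfg (set_nth 0 rs x n) ars i o
  | CCopy x y => Cfg (set_nth 0 rs x (nth 0 rs y)) ars i o
  | CSucc x => Cfg (set_nth 0 rs x (nth 0 rs x).+1) ars i o
  | CPred x => Cfg (set_nth 0 rs x (nth 0 rs x).-1) ars i o
  | CLoad x a y =>
      Cfg (set_nth 0 rs x (nth 0 (nth [::] ars a) (nth 0 rs y))) ars i o
  | CStore a x y =>
      Cfg rs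
        (set_nth [::] ars a (set_nth 0 (nth [::] ars a) (nth 0 rs x) (nth 0 rs y)))
        i o
  | CRead x => Cfg (set_nth 0 rs x (head 0 i)) ars (behead i) o
  | CWrite x => Cfg rs ars i (rcons o (nth 0 rs x))
  | CSeq p q => eval q (eval p c)
  | CIf x p q => if nth 0 rs x != 0 then eval p c else eval q c
  end.

Definition runs (p : com) (c : cfg) (t : nat) (c' : cfg) : Prop :=
  exists2 t', exec p (state_of c) t' (state_of c') & t' <= t.

Lemma set_reg_cfg rs ars i o x v :
  set_reg (state_of (Cfg rs ars i o)) x v
  = state_of (Cfg (set_nth 0 rs x v) ars i o).
Proof.
rewrite /set_reg /state_of /=; congr State.
by apply: functional_extensionality => y; rewrite nth_set_nth.
Qed.

Lemma set_arr_cfg rs ars i o a j v :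
  set_arr (state_of (Cfg rs ars i o)) a j v
  = state_of (Cfg rs (set_nth [::] ars a (set_nth 0 (nth [::] ars a) j v)) i o).
Proof.
rewrite /set_arr /state_of /=; congr State.
apply: functional_extensionality => b; apply: functional_extensionality => k.
rewrite nth_set_nth /=; case: eqP => [->|_] //=.
by rewrite nth_set_nth.
Qed.

(** Loop-free programs are run by computation, so that only loops need
    invariants. *)
Lemma runs_eval p c : straight p -> runs p c (steps p) (eval p c).
Proof.
elim: p c => [|x n|x y|x|x|x a y|a x y|x|x|p IHp q IHq|x p IHp q IHq|//] c //=;
  try by move=> _; exists 1 => //; case: c => rs ars i o;
    rewrite -?set_reg_cfg -?set_arr_cfg; constructor.
- case/andP=> /(IHp c)[t tp le_t] /(IHq (eval p c))[t' tq le_t'].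
  by exists (t + t'); [case: c tp tq => *; apply: ESeq; eassumption | lia].
- case/andP=> /(IHp c)[t tp le_t] /(IHq c)[t' tq le_t'].
  case: c tp tq => rs ars i o tp tq.
  have [x0|x0] := eqVneq (nth 0 rs x) 0.
    by exists t'.+1; [apply: EIfFalse | lia].
  by exists t.+1; [apply: EIfTrue | lia].
Qed.

Lemma runs_le p c t t' c' : runs p c t c' -> t <= t' -> runs p c t' c'.
Proof. by case=> u ? ? ?; exists u => //; lia. Qed.

Lemma runs_straight p c c' t :
  straight p && (steps p <= t) -> eval p c = c' -> runs p c t c'.
Proof. by case/andP=> p_straight le_t <-; apply: runs_le (runs_eval c _) _. Qed.

Lemma runs_seq p q c c' c'' t t' :
  runs p c t c' -> runs q c' t' c'' -> runs (CSeq p q) c (t + t') c''.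
Proof.
case=> u pu le_u [v qv le_v]; exists (u + v); last by lia.
by apply: ESeq; eassumption.
Qed.

Lemma runs_if x p q c c' t :
  (nth 0 (regs c) x != 0 -> runs p c t c') ->
  (nth 0 (regs c) x = 0 -> runs q c t c') ->
  runs (CIf x p q) c t.+1 c'.
Proof.
move=> pP qP; have [x0|x0] := eqVneq (nth 0 (regs c) x) 0.
  by case: (qP x0) => u qu le_u; exists u.+1 => //; apply: EIfFalse.
by case: (pP x0) => u qu le_u; exists u.+1 => //; apply: EIfTrue.
Qed.

Lemma runs_while0 x p c : nth 0 (regs c) x = 0 -> runs (CWhile x p) c 1 c.
Proof. by move=> x0; exists 1 => //; apply: EWhileFalse. Qed.

Lemma runs_whileS x p c c' c'' t t' :
  nth 0 (regs c) x != 0 -> runs p c t c' -> runs (CWhile x p) c' t' c'' ->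
  runs (CWhile x p) c (t + t').+1 c''.
Proof.
move=> x0 [u pu le_u] [v pv le_v]; exists (u + v).+1; last by lia.
by apply: EWhileTrue; eassumption.
Qed.

Lemma runs_computes p i o t c' k :
  runs p (Cfg (nseq k 0) [:: [::]; [::]] i [::]) t c' -> output c' = o ->
  computes p i o t.
Proof.
by case=> t' pt' le_t' <-; exists (state_of c'), t'; rewrite (init_cfg _ k).
Qed.

Local Notation "p ;; q" := (CSeq p q) (at level 62, right associativity).
(** [rN], [rC]: numbers of variables and clauses; [rM], [rK]: clauses and inner
    iterations still to do; [rP]: next index in an array; [rV], [rH]: numbers of
    elements and hyperedges; [rF]: first unused element number; [rO]: number or
    bit of the latest gate; [rRho], [rQ]: numbers of [rho] and of the latest [q];
    [rX], [rT]: value just read and constant to be written. *)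
Local Notation rN := 0 (only parsing).
Local Notation rM := 1 (only parsing).
Local Notation rK := 2 (only parsing).
Local Notation rX := 3 (only parsing).
Local Notation rP := 4 (only parsing).
Local Notation rV := 5 (only parsing).
Local Notation rH := 6 (only parsing).
Local Notation rC := 7 (only parsing).
Local Notation rF := 8 (only parsing).
Local Notation rO := 9 (only parsing).
Local Notation rRho := 10 (only parsing).
Local Notation rQ := 11 (only parsing).
Local Notation rT := 12 (only parsing).

(** * Reading a Horn CNF *)

Definition clause_code (C : clause nat) : seq nat :=
  size (prem C) :: prem C ++ (if concl C is Some b then [:: 1; b] else [:: 0]).

Arguments clause_code : simpl never.

Definition cnf_code (D : cnf nat) : seq nat := flatten (map clause_code D).

Definition num_elts T (C : clause T) : nat :=
  (if prem C is _ :: A then (size A).*2 else 1) + isSome (concl C).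

Definition num_edges T (C : clause T) : nat :=
  (if prem C is _ :: A then 3 * size A else 1) + (isSome (concl C)).+1.

Definition store_next (x : nat) : com :=
  CRead x ;; CStore 0 rP x ;; CSucc rP.

(** The first premise entry creates no element, each later one creates [o_i] and
    [q_i] and three hyperedges.  The register for the value just read is zeroed
    after use, here and in all programs below: the configuration reached is then
    a function of the data, and the lemma on a loop is an equation proved by
    induction on the list that it traverses. *)
Definition parse_premise : com :=
  CWhile rK
    (CPred rK ;; store_next rX ;;
     CSucc rV ;; CSucc rV ;; CSucc rH ;; CSucc rH ;; CSucc rH ;; CConst rX 0).

Definition parse_clause : com :=
  (CPred rM ;; store_next rK) ;;
  CIf rK ((CPred rK ;; store_next rX ;; CConst rX 0) ;; parse_premise)
    (CSucc rV ;; CSucc rH) ;;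
  (store_next rX ;; CSucc rH ;;
   CIf rX (store_next rX ;; CSucc rV ;; CSucc rH) CSkip ;; CConst rX 0).

(** The clauses are kept in array 0, because the numbers of elements and of
    hyperedges must be written before any hyperedge; both are counted while
    reading. *)
Definition parse : com :=
  (CRead rN ;; CRead rM ;; CCopy rC rM ;; CCopy rV rN ;; CSucc rV ;; CSucc rV ;;
   CCopy rH rN ;; CSucc rH) ;;
  CWhile rM parse_clause.

(** [w] is the part of the clauses read so far. *)
Definition parse_cfg n m k w V H c i : cfg :=
  Cfg [:: n; m; k; 0; size w; V; H; c; 0; 0; 0; 0; 0] [:: w; [::]] i [::].
Arguments parse_cfg : simpl never.

Lemma set_nth_size T (x0 : T) s x : set_nth x0 s (size s) x = rcons s x.
Proof. by elim: s => //= y s ->. Qed.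

Lemma set_nth_size1 T (x0 : T) s y x :
  set_nth x0 (rcons s y) (size s).+1 x = rcons (rcons s y) x.
Proof. by rewrite -(size_rcons s y) set_nth_size. Qed.

Local Ltac cfg_eq :=
  rewrite /= ?(set_nth_size, set_nth_size1) -?cats1; do ?[rewrite -catA /=];
  congr Cfg; do ?[congr cons]; do ?[rewrite size_cat /=]; first [done | lia].

Lemma parse_premise_runs n m w V H c l i :
  runs parse_premise (parse_cfg n m (size l) w V H c (l ++ i))
    (12 * size l + 1)
    (parse_cfg n m 0 (w ++ l) (V + (size l).*2) (H + 3 * size l) c i).
Proof.
elim: l w V H => [|a l IHl] w V H.
  by rewrite cats0 !addn0; apply: runs_while0.
apply: (@runs_le _ _ (11 + (12 * size l + 1)).+1); last by rewrite /=; lia.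
have -> : parse_cfg n m 0 (w ++ a :: l) (V + (size (a :: l)).*2)
            (H + 3 * size (a :: l)) c i
        = parse_cfg n m 0 (rcons w a ++ l) (V.+2 + (size l).*2)
            (H.+3 + 3 * size l) c i.
  by rewrite /parse_cfg; cfg_eq.
apply: runs_whileS (IHl _ _ _) => //.
by apply: runs_straight => //; rewrite /parse_cfg; cfg_eq.
Qed.

Lemma parse_clause_runs n m w V H c (C : clause nat) i :
  runs parse_clause (parse_cfg n m.+1 0 w V H c (clause_code C ++ i))
    (12 * size (clause_code C) + 30)
    (parse_cfg n m 0 (w ++ clause_code C) (V + num_elts C) (H + num_edges C) c i).
Proof.
case: C => l b; rewrite /clause_code /num_elts /num_edges /=.
set tl := (if b is Some _ then _ else _).
set V' := (if l is _ :: _ then _ else _); set H' := (if l is _ :: _ then _ else _).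
apply: (@runs_le _ _ (4 + ((5 + (12 * size l + 1)).+1 + 16))); last first.
  by rewrite size_cat mulnS; case: b @tl => [b|] /=; lia.
pose mid := parse_cfg n m 0 (w ++ size l :: l) (V + V') (H + H') c (tl ++ i).
apply: runs_seq; first by apply: runs_straight.
apply: (@runs_seq _ _ _ mid).
  rewrite /= set_nth_size -catA {}/mid {}/V' {}/H'; apply: runs_if => /=.
    case: l => [//|a l] _.
    have -> : w ++ size (a :: l) :: a :: l = (rcons (rcons w (size l).+1) a) ++ l.
      by rewrite !cat_rcons.
    apply: (@runs_le _ _ (5 + (12 * size l + 1))); last by rewrite /=; lia.
    apply: runs_seq (parse_premise_runs _ _ _ _ _ _ _ _).
    by apply: runs_straight => //; rewrite /parse_cfg; cfg_eq.
  case: l => // _; apply: (@runs_le _ _ 2) => //.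
  by apply: runs_straight => //; rewrite /parse_cfg; cfg_eq.
by apply: runs_straight => //; rewrite /mid /tl; case: (b) => [b'|];
   rewrite /parse_cfg; cfg_eq.
Qed.

Lemma cnf_code_cons C D : cnf_code (C :: D) = clause_code C ++ cnf_code D.
Proof. by []. Qed.

Lemma runs_parse_clauses n w V H c D i :
  runs (CWhile rM parse_clause)
    (parse_cfg n (size D) 0 w V H c (cnf_code D ++ i))
    (30 * size (cnf_code D) + 1)
    (parse_cfg n 0 0 (w ++ cnf_code D) (V + sumn (map (@num_elts nat) D))
       (H + sumn (map (@num_edges nat) D)) c i).
Proof.
elim: D w V H => [|C D IHD] w V H.
  by rewrite cats0 !addn0; apply: runs_while0.
rewrite cnf_code_cons -catA [size _]/= ![sumn _]/=.
apply: (@runs_le _ _ (12 * size (clause_code C) + 30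
                      + (30 * size (cnf_code D) + 1)).+1).
  apply: (@runs_whileS _ _ _
    (parse_cfg n (size D) 0 (w ++ clause_code C) (V + num_elts C)
       (H + num_edges C) c (cnf_code D ++ i))) => //.
    exact: parse_clause_runs.
  by rewrite catA !addnA; apply: IHD.
have : 2 <= size (clause_code C).
  by case: C => l [b|]; rewrite /clause_code /= size_cat /=; lia.
by rewrite size_cat; lia.
Qed.

Lemma runs_parse n D i :
  runs parse (Cfg (nseq 13 0) [:: [::]; [::]] (n :: size D :: cnf_code D ++ i) [::])
    (30 * size (cnf_code D) + 9)
    (parse_cfg n 0 0 (cnf_code D) (n.+2 + sumn (map (@num_elts nat) D))
       (n.+1 + sumn (map (@num_edges nat) D)) (size D) i).
Proof.
apply: (@runs_le _ _ (8 + (30 * size (cnf_code D) + 1))); last by lia.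
apply: runs_seq (@runs_parse_clauses n [::] n.+2 n.+1 (size D) D i).
by apply: runs_straight => //; rewrite /parse_cfg.
Qed.

(** * Writing the hypergraph *)

Definition next (x : nat) : com := CLoad x 0 rP ;; CSucc rP.

Definition emit (n : nat) : com := CConst rT n ;; CWrite rT.

Definition clear : com := CConst rX 0 ;; CConst rQ 0 ;; CConst rT 0.

(** [p] is the number of [o_(i-1)] and [f] the first unused number.  Elements are
    numbered in the order of their creation, so that [o_i] and [q_i] get [f] and
    [f.+1], and a counter suffices to find the number of every element. *)
Fixpoint chain_code (p f : nat) (A : seq nat) : seq nat :=
  if A is a :: A' then
    [:: 2; f; f.+1; 3; p; a; f; 3; p; f; f.+1] ++ chain_code f f.+2 A'
  else [::].

Fixpoint chain_out (p f : nat) (A : seq nat) : nat :=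
  if A is _ :: A' then chain_out f f.+2 A' else p.

(** [n] is the number of [r], which follows the [n] variables. *)
Definition clause_edges_code (n f : nat) (C : clause nat) : seq nat :=
  let o := if prem C is a :: A then chain_out a f A else f in
  (if prem C is a :: A then chain_code a f A else [:: 1; f]) ++
  (if concl C is Some b then
     let q := f + (if prem C is _ :: A then (size A).*2 else 1) in
     [:: 2; o; q; 3; b; o; q]
   else [:: 2; o; n]).

Fixpoint cnf_edges_code (n f : nat) (D : cnf nat) : seq nat :=
  if D is C :: D' then
    clause_edges_code n f C ++ cnf_edges_code n (f + num_elts C) D'
  else [::].

Definition emit_chain : com :=
  CWhile rK
    (CPred rK ;; next rX ;; CCopy rQ rF ;; CSucc rQ ;;
     emit 2 ;; CWrite rF ;; CWrite rQ ;;
     emit 3 ;; CWrite rO ;; CWrite rX ;; CWrite rF ;;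
     emit 3 ;; CWrite rO ;; CWrite rF ;; CWrite rQ ;;
     CCopy rO rF ;; CSucc rF ;; CSucc rF ;; clear).

Definition emit_clause : com :=
  (CPred rM ;; next rK) ;;
  CIf rK ((CPred rK ;; next rO) ;; emit_chain)
    (emit 1 ;; CWrite rF ;; CCopy rO rF ;; CSucc rF ;; clear) ;;
  (next rX ;;
   CIf rX
     (next rX ;; emit 2 ;; CWrite rO ;; CWrite rF ;;
      emit 3 ;; CWrite rX ;; CWrite rO ;; CWrite rF ;; CSucc rF)
     (emit 2 ;; CWrite rO ;; CWrite rN) ;;
   CConst rO 0 ;; clear).

Definition emit_vars : com :=
  CWhile rK
    (CPred rK ;; emit 3 ;; CWrite rX ;; CWrite rN ;; CWrite rRho ;; CSucc rX ;;
     CConst rT 0).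

Definition build : com :=
  parse ;;
  (CWrite rV ;; CWrite rH ;; CCopy rRho rN ;; CSucc rRho ;;
   emit 2 ;; CWrite rN ;; CWrite rRho ;; CCopy rK rN ;; CConst rT 0) ;;
  emit_vars ;;
  (clear ;; CConst rP 0 ;; CCopy rM rC ;; CCopy rF rRho ;; CSucc rF) ;;
  CWhile rM emit_clause.

(** The clauses have been processed up to [w], and [z] remains; [f] is the first
    unused number and [p] the number of the latest gate. *)
Definition emit_cfg n m k V H c f p w z o : cfg :=
  Cfg [:: n; m; k; 0; size w; V; H; c; f; p; n.+1; 0; 0] [:: w ++ z; [::]] [::] o.
Arguments emit_cfg : simpl never.

Lemma nth_size0 T (x0 : T) w x z : nth x0 (w ++ x :: z) (size w) = x.
Proof. by rewrite nth_cat ltnn subnn. Qed.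

Lemma nth_size1 T (x0 : T) w x y z : nth x0 (w ++ x :: y :: z) (size w).+1 = y.
Proof. by rewrite nth_cat ltnNge leqnSn subSnn. Qed.

Local Ltac emit_eq :=
  rewrite /= ?(nth_size0, nth_size1) /= ?cats0 -?cats1; do ?[rewrite -catA /=];
  congr Cfg; do ?[congr cons]; do ?[rewrite size_cat /=]; first [done | lia].

Lemma runs_emit_chain n m V H c f p w l z o :
  runs emit_chain (emit_cfg n m (size l) V H c f p w (l ++ z) o)
    (30 * size l + 1)
    (emit_cfg n m 0 V H c (f + (size l).*2) (chain_out p f l) (w ++ l) z
       (o ++ chain_code p f l)).
Proof.
elim: l f p w o => [|a l IHl] f p w o.
  by rewrite !cats0 !addn0; apply: runs_while0.
apply: (@runs_le _ _ (29 + (30 * size l + 1)).+1); last by rewrite /=; lia.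
have -> : emit_cfg n m 0 V H c (f + (size (a :: l)).*2) (chain_out p f (a :: l))
       (w ++ a :: l) z (o ++ chain_code p f (a :: l))
     = emit_cfg n m 0 V H c (f.+2 + (size l).*2) (chain_out f f.+2 l)
       (rcons w a ++ l) z
       ((o ++ [:: 2; f; f.+1; 3; p; a; f; 3; p; f; f.+1]) ++ chain_code f f.+2 l).
  by rewrite /emit_cfg; emit_eq.
apply: runs_whileS (IHl _ _ _ _) => //.
by apply: runs_straight => //; rewrite /emit_cfg; emit_eq.
Qed.

Lemma runs_emit_clause n m V H c f w C z o :
  runs emit_clause (emit_cfg n m.+1 0 V H c f 0 w (clause_code C ++ z) o)
    (30 * size (clause_code C) + 40)
    (emit_cfg n m 0 V H c (f + num_elts C) 0 (w ++ clause_code C) z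
       (o ++ clause_edges_code n f C)).
Proof.
case: C => l b; rewrite /clause_code /num_elts /clause_edges_code /=.
set tl := (if b is Some _ then _ else _).
apply: (@runs_le _ _ (3 + ((10 + (30 * size l + 1)).+1 + 26))); last first.
  by rewrite size_cat mulnS; case: b @tl => [b|] /=; lia.
pose mid := emit_cfg n m 0 V H c
  (f + (if l is _ :: A then (size A).*2 else 1))
  (if l is a :: A then chain_out a f A else f) (w ++ size l :: l) (tl ++ z)
  (o ++ (if l is a :: A then chain_code a f A else [:: 1; f])).
apply: runs_seq; first by apply: runs_straight.
apply: (@runs_seq _ _ _ mid).
  rewrite /= nth_size0 -catA {}/mid; apply: runs_if => /=.
    case: l => [//|a l] _.
    have -> : w ++ size (a :: l) :: a :: l = (rcons (rcons w (size l).+1) a) ++ l.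
      by rewrite !cat_rcons.
    apply: (@runs_le _ _ (10 + (30 * size l + 1))); last by rewrite /=; lia.
    apply: runs_seq (runs_emit_chain _ _ _ _ _ _ _ _ _ _ _).
    by apply: runs_straight => //; rewrite /emit_cfg; emit_eq.
  case: l => // _; apply: (@runs_le _ _ 8) => //.
  by apply: runs_straight => //; rewrite /emit_cfg; emit_eq.
by apply: runs_straight => //; rewrite /mid /tl; case: (b) => [b'|];
   rewrite /emit_cfg; emit_eq.
Qed.

Lemma runs_emit_clauses n V H c f w D z o :
  exists f',
  runs (CWhile rM emit_clause)
    (emit_cfg n (size D) 0 V H c f 0 w (cnf_code D ++ z) o)
    (60 * size (cnf_code D) + 1)
    (emit_cfg n 0 0 V H c f' 0 (w ++ cnf_code D) z (o ++ cnf_edges_code n f D)).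
Proof.
elim: D f w o => [|C D IHD] f w o.
  by exists f; rewrite !cats0; apply: runs_while0.
have [f' IH] := IHD (f + num_elts C) (w ++ clause_code C)
                  (o ++ clause_edges_code n f C).
exists f'; rewrite cnf_code_cons -catA [size _]/= [cnf_edges_code _ _ _]/=.
apply: (@runs_le _ _ (30 * size (clause_code C) + 40
                      + (60 * size (cnf_code D) + 1)).+1).
  apply: runs_whileS (runs_emit_clause _ _ _ _ _ _ _ _ _ _) _ => //.
  by rewrite !catA in IH *.
have : 2 <= size (clause_code C).
  by case: C {IH} => l [b|]; rewrite /clause_code /= size_cat /=; lia.
by rewrite size_cat; lia.
Qed.

Lemma runs_emit_vars n x k V H c w o :
  runs emit_vars
    (Cfg [:: n; 0; k; x; size w; V; H; c; 0; 0; n.+1; 0; 0] [:: w; [::]] [::] o)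
    (10 * k + 1)
    (Cfg [:: n; 0; 0; x + k; size w; V; H; c; 0; 0; n.+1; 0; 0] [:: w; [::]] [::]
       (o ++ flatten [seq [:: 3; v; n; n.+1] | v <- iota x k])).
Proof.
elim: k x o => [|k IHk] x o; first by rewrite cats0 addn0; apply: runs_while0.
apply: (@runs_le _ _ (9 + (10 * k + 1)).+1); last by lia.
have := IHk x.+1 (o ++ [:: 3; x; n; n.+1]).
rewrite -catA addSnnS => IH; apply: runs_whileS IH => //.
by apply: runs_straight => //; emit_eq.
Qed.

Lemma runs_build n D :
  exists c',
    runs build (Cfg (nseq 13 0) [:: [::]; [::]] (n :: size D :: cnf_code D) [::])
      (90 * size (cnf_code D) + 10 * n + 40) c' /\
    output c' =
      [:: n.+2 + sumn (map (@num_elts nat) D);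
          n.+1 + sumn (map (@num_edges nat) D); 2; n; n.+1]
      ++ flatten [seq [:: 3; v; n; n.+1] | v <- iota 0 n]
      ++ cnf_edges_code n n.+2 D.
Proof.
set V := n.+2 + _; set H := n.+1 + _.
have [f' runs_clauses] := runs_emit_clauses n V H (size D) n.+2 [::] D [::]
  ([:: V; H; 2; n; n.+1] ++ flatten [seq [:: 3; v; n; n.+1] | v <- iota 0 n]).
eexists; split.
  apply: (@runs_le _ _ (30 * size (cnf_code D) + 9
    + (10 + (10 * n + 1 + (7 + (60 * size (cnf_code D) + 1)))))); last by lia.
  (* The parser leaves the input after the clauses, here nothing, unread. *)
  rewrite -[cnf_code D in X in Cfg _ _ X _]cats0.
  apply: runs_seq (runs_parse _ _ _) _.
  apply: runs_seq; first by apply: runs_straight.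
  rewrite /parse_cfg /=; apply: runs_seq (runs_emit_vars _ 0 _ _ _ _ _ _) _.
  apply: runs_seq (runs_clauses).
  by apply: runs_straight => //; rewrite /emit_cfg cats0.
by rewrite /emit_cfg /= -?catA.
Qed.

(** * Evaluating the gates *)

(** Disjunction with the bit [v] for [z = 0] and conjunction for [z = 1].  The two
    cases serve the two maps: a gate is in the image of a set of false variables if
    some of its premise variables is false, and in the image of a model if all of
    them are true. *)
Definition combine (z acc v : nat) : nat :=
  if v != 0 then (if z != 0 then acc else 1) else (if z != 0 then 0 else acc).

Fixpoint chain_bits (z : nat) (b : seq nat) (acc : nat) (A : seq nat) : seq nat :=
  if A is a :: A' then
    let acc' := combine z acc (nth 0 b a) in
    [:: acc'; acc'] ++ chain_bits z b acc' A'
  else [::].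

Definition premise_bit (z : nat) (b A : seq nat) : nat :=
  foldl (combine z) z (map (nth 0 b) A).

Definition clause_bits (z : nat) (b : seq nat) (C : clause nat) : seq nat :=
  (if prem C is a :: A then chain_bits z b (combine z z (nth 0 b a)) A
   else [:: z]) ++
  (if concl C is Some _ then [:: premise_bit z b (prem C)] else [::]).

Definition combine_next (z : nat) : com :=
  next rX ;; CLoad rX 1 rX ;;
  CIf rX (if z != 0 then CSkip else CConst rO 1)
         (if z != 0 then CConst rO 0 else CSkip) ;;
  CConst rX 0.

Definition bits_chain (z : nat) : com :=
  CWhile rK (CPred rK ;; combine_next z ;; CWrite rO ;; CWrite rO).

Definition bits_clause (z : nat) : com :=
  (CPred rM ;; CConst rO z ;; next rK) ;;
  CIf rK ((CPred rK ;; combine_next z) ;; bits_chain z) (CWrite rO) ;;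
  (next rX ;; CIf rX (CWrite rO ;; CSucc rP) CSkip ;; CConst rO 0 ;; CConst rX 0).

Definition copy_bits : com :=
  CWhile rK
    (CPred rK ;; CRead rX ;; CWrite rX ;; CStore 1 rP rX ;; CSucc rP ;;
     CConst rX 0).

(** The bits of [r] and [rho] are 1 in the stopping set and 0 in its complement. *)
Definition forward (z : nat) : com :=
  parse ;;
  (CConst rP 0 ;; CCopy rK rN) ;;
  copy_bits ;;
  (CConst rX (z == 0) ;; CWrite rX ;; CWrite rX ;; CConst rX 0 ;;
   CConst rP 0 ;; CCopy rM rC) ;;
  CWhile rM (bits_clause z).

(** The variables come first in the ground set, so that restricting to them is
    copying a prefix of the input bits. *)
Definition backward : com :=
  parse ;;
  (CConst rP 0 ;; CCopy rK rN) ;;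
  copy_bits.

Definition bits_cfg n m k V H c acc b w y i o : cfg :=
  Cfg [:: n; m; k; 0; size w; V; H; c; 0; acc; 0; 0; 0] [:: w ++ y; b] i o.
Arguments bits_cfg : simpl never.

Lemma runs_copy_bits n V H c w b b' i o :
  runs copy_bits
    (Cfg [:: n; 0; size b'; 0; size b; V; H; c; 0; 0; 0; 0; 0] [:: w; b] (b' ++ i) o)
    (8 * size b' + 1)
    (Cfg [:: n; 0; 0; 0; size b + size b'; V; H; c; 0; 0; 0; 0; 0] [:: w; b ++ b'] i
       (o ++ b')).
Proof.
elim: b' b o => [|v b' IHb] b o; first by rewrite !cats0 addn0; apply: runs_while0.
apply: (@runs_le _ _ (7 + (8 * size b' + 1)).+1); last by rewrite /=; lia.
have := IHb (rcons b v) (rcons o v); rewrite size_rcons addSnnS !cat_rcons.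
move=> IH; apply: runs_whileS IH => //.
by apply: runs_straight => //; cfg_eq.
Qed.

Lemma runs_bits_chain z n m V H c acc b w l y i o :
  runs (bits_chain z)
    (bits_cfg n m (size l) V H c acc b w (l ++ y) i o)
    (12 * size l + 1)
    (bits_cfg n m 0 V H c (foldl (combine z) acc (map (nth 0 b) l)) b (w ++ l) y i
       (o ++ chain_bits z b acc l)).
Proof.
elim: l acc w o => [|a l IHl] acc w o.
  by rewrite !cats0; apply: runs_while0.
apply: (@runs_le _ _ (11 + (12 * size l + 1)).+1); last by rewrite /=; lia.
have := IHl (combine z acc (nth 0 b a)) (rcons w a)
  (o ++ [:: combine z acc (nth 0 b a); combine z acc (nth 0 b a)]).
rewrite cat_rcons -catA => IH; apply: runs_whileS IH => //.
apply: runs_straight; first by case: z {IHl}.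
rewrite /bits_cfg /combine; case: z {IHl} => [|z].
  by rewrite /= !nth_size0; case: (nth 0 b a) => [|?]; emit_eq.
by rewrite /= !nth_size0; case: (nth 0 b a) => [|?]; emit_eq.
Qed.

Lemma runs_bits_clause z n m V H c b w C y i o :
  runs (bits_clause z)
    (bits_cfg n m.+1 0 V H c 0 b w (clause_code C ++ y) i o)
    (12 * size (clause_code C) + 30)
    (bits_cfg n m 0 V H c 0 b (w ++ clause_code C) y i (o ++ clause_bits z b C)).
Proof.
case: C => l d; rewrite /clause_code /clause_bits /premise_bit /=.
set tl := (if d is Some _ then _ else _).
apply: (@runs_le _ _ (4 + ((10 + (12 * size l + 1)).+1 + 10))); last first.
  by rewrite size_cat mulnS; lia.
pose mid := bits_cfg n m 0 V H c (foldl (combine z) z (map (nth 0 b) l)) b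
  (w ++ size l :: l) (tl ++ y) i
  (o ++ (if l is a :: A then chain_bits z b (combine z z (nth 0 b a)) A else [:: z])).
apply: runs_seq; first by apply: runs_straight.
apply: (@runs_seq _ _ _ mid).
  rewrite /= nth_size0 -catA {}/mid; apply: runs_if => /=.
    case: l => [//|a l] _.
    have -> : w ++ size (a :: l) :: a :: l = (rcons (rcons w (size l).+1) a) ++ l.
      by rewrite !cat_rcons.
    apply: (@runs_le _ _ (10 + (12 * size l + 1))); last by rewrite /=; lia.
    apply: runs_seq (runs_bits_chain _ _ _ _ _ _ _ _ _ _ _ _ _).
    apply: runs_straight; first by case: z.
    rewrite /bits_cfg /combine; case: z => [|z].
      by rewrite /= !nth_size1; case: (nth 0 b a) => [|?]; emit_eq.
    by rewrite /= !nth_size1; case: (nth 0 b a) => [|?]; emit_eq.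
  case: l => // _; apply: (@runs_le _ _ 1) => //.
  by apply: runs_straight => //; rewrite /bits_cfg; emit_eq.
by apply: runs_straight => //; rewrite /mid /tl; case: (d) => [d'|];
   rewrite /bits_cfg; emit_eq.
Qed.

Lemma runs_bits_clauses z n V H c b w D i o :
  runs (CWhile rM (bits_clause z))
    (bits_cfg n (size D) 0 V H c 0 b w (cnf_code D) i o)
    (30 * size (cnf_code D) + 1)
    (bits_cfg n 0 0 V H c 0 b (w ++ cnf_code D) [::] i
       (o ++ flatten (map (clause_bits z b) D))).
Proof.
elim: D w o => [|C D IHD] w o.
  by rewrite !cats0; apply: runs_while0.
have := IHD (w ++ clause_code C) (o ++ clause_bits z b C).
rewrite -[(w ++ _) ++ _]catA -[(o ++ _) ++ _]catA => IH.
rewrite cnf_code_cons [size _]/= [flatten _]/=.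
apply: (@runs_le _ _ (12 * size (clause_code C) + 30
                      + (30 * size (cnf_code D) + 1)).+1).
  by apply: runs_whileS (runs_bits_clause _ _ _ _ _ _ _ _ _ _ _ _) IH.
have : 2 <= size (clause_code C).
  by case: C {IH} => l [d|]; rewrite /clause_code /= size_cat /=; lia.
by rewrite size_cat; lia.
Qed.

Lemma runs_forward z n D b :
  size b = n ->
  exists c',
    runs (forward z)
      (Cfg (nseq 13 0) [:: [::]; [::]] (n :: size D :: cnf_code D ++ b) [::])
      (60 * size (cnf_code D) + 8 * n + 40) c' /\
    output c' = b ++ [:: (z == 0) : nat; (z == 0) : nat]
      ++ flatten (map (clause_bits z b) D).
Proof.
move=> size_b; eexists; split.
  apply: (@runs_le _ _ (30 * size (cnf_code D) + 9
    + (2 + (8 * size b + 1 + (6 + (30 * size (cnf_code D) + 1)))))); last first.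
    by rewrite size_b; lia.
  rewrite -[b in X in Cfg _ _ X _]cats0.
  apply: runs_seq (runs_parse _ _ _) _.
  apply: runs_seq; first by apply: runs_straight.
  rewrite /parse_cfg /= -size_b; apply: runs_seq (runs_copy_bits _ _ _ _ _ [::] _ _ _) _.
  apply: runs_seq _ (@runs_bits_clauses z (size b) _ _ _ b [::] D [::] _).
  by apply: runs_straight => //; rewrite /bits_cfg.
by rewrite /bits_cfg /= -?cats1 -?catA.
Qed.

Lemma runs_backward n D b i :
  size b = n ->
  exists c',
    runs backward
      (Cfg (nseq 13 0) [:: [::]; [::]] (n :: size D :: cnf_code D ++ b ++ i) [::])
      (30 * size (cnf_code D) + 8 * n + 20) c' /\
    output c' = b.
Proof.
move=> size_b; eexists; split.
  apply: (@runs_le _ _ (30 * size (cnf_code D) + 9 + (2 + (8 * size b + 1)))).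
    apply: runs_seq (runs_parse _ _ _) _.
    apply: runs_seq; first by apply: runs_straight.
    by rewrite /parse_cfg /= -size_b; apply: (runs_copy_bits _ _ _ _ _ [::] _ _ _).
  by rewrite size_b; lia.
by [].
Qed.
(** * The ground set *)

Lemma indexedE A (d : A) (s : seq A) :
  indexed s = [seq (c, nth d s c) | c <- iota 0 (size s)].
Proof. by rewrite /indexed -{2}(mkseq_nth d s) -{1}[iota _ _]map_id zip_map. Qed.

Lemma uniq_flatten_map (A B : eqType) (s : seq A) (F : A -> seq B) :
  uniq s -> {in s, forall x, uniq (F x)} ->
  {in s &, forall x y b, b \in F x -> b \in F y -> x = y} ->
  uniq (flatten (map F s)).
Proof.
elim: s => //= x s IHs /andP[xs s_uniq] F_uniq F_inj.
rewrite cat_uniq F_uniq ?mem_head // IHs // ?andbT.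
- apply/hasPn => b /flatten_mapP[y ys bFy]; apply: contra xs => bFx.
  by rewrite (F_inj x y _ _ b) ?inE ?eqxx ?ys ?orbT.
- by move=> y ys; apply: F_uniq; rewrite inE ys orbT.
- by move=> y z ys zs; apply: F_inj; rewrite inE ?ys ?zs orbT.
Qed.

Definition noclause T : clause T := Clause [::] None.

(** Separates the elements, and with them the hyperedges, of different clauses. *)
Definition owner T (u : elt T) : option nat :=
  match u with Oelt c _ | Qelt c _ | QCelt c => Some c | _ => None end.

Lemma owner_clause_elts (T : choiceType) c (C : clause T) u :
  u \in clause_elts c C -> owner u = Some c.
Proof.
rewrite mem_cat => /orP[|]; last by case: (concl C) => // b; rewrite inE => /eqP->.
case: (prem C) => [|a A]; first by rewrite inE => /eqP->.
by case/flatten_mapP=> i _; rewrite !inE => /orP[]/eqP->.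
Qed.

Lemma mem_elts (T : choiceType) (X : {fset T}) G u :
  (u \in elts X G) =
  match u with
  | Var x => x \in X
  | Relt | Rhoelt => true
  | Oelt c _ | Qelt c _ | QCelt c =>
      (c < size G) && (u \in clause_elts c (nth (noclause T) G c))
  end.
Proof.
have in_clauses : (u \in flatten [seq clause_elts cC.1 cC.2 | cC <- indexed G]) =
    if owner u is Some c then
      (c < size G) && (u \in clause_elts c (nth (noclause T) G c)) else false.
  rewrite (indexedE (noclause T)) -map_comp.
  apply/flatten_mapP/idP => [[c]|].
    by rewrite mem_iota /= => cG uC; rewrite (owner_clause_elts uC) cG.
  case: (owner u) => // c /andP[cG uC]; exists c => //.
  by rewrite mem_iota.
rewrite mem_cat !inE in_clauses.
have -> : (u \in [seq Var x | x <- enum_fset X]) = if u is Var x then x \in X else false.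
  case: u {in_clauses} => [x|c i|c i|c||]; try by apply/negP => /mapP[].
  by rewrite mem_map // => ? ? [].
by case: u {in_clauses} => * //=; rewrite orbF.
Qed.

Lemma uniq_elts (T : choiceType) (X : {fset T}) G : uniq (elts X G).
Proof.
have clauses_uniq : uniq (flatten [seq clause_elts cC.1 cC.2 | cC <- indexed G]).
  rewrite (indexedE (noclause T)) -map_comp; apply: uniq_flatten_map.
  - exact: iota_uniq.
  - move=> c _ /=; move: (nth _ _ _) => C; rewrite cat_uniq.
    apply/and3P; split.
    + case: (prem C) => [//|a A]; apply: uniq_flatten_map => [||i j _ _ u].
      * exact: iota_uniq.
      * by move=> i _.
      * by rewrite !inE => /orP[]/eqP-> /orP[]/eqP[].
    + case: (concl C) => //= b; rewrite orbF; case: (prem C) => [//|a A].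
      by apply/negP => /flatten_mapP[i _]; rewrite !inE.
    + by case: (concl C).
  - by move=> c c' _ _ u /owner_clause_elts uc /owner_clause_elts; rewrite uc => -[].
rewrite cat_uniq; apply/and3P; split.
- by rewrite map_inj_uniq ?fset_uniq // => ? ? [].
- apply/hasPn => u; apply: contraL => /mapP[x _ ->].
  rewrite mem_cat !inE /= (indexedE (noclause T)) -map_comp.
  by apply/flatten_mapP => -[c _ /owner_clause_elts].
rewrite cat_uniq clauses_uniq andbT /=.
apply/hasPn => u; rewrite (indexedE (noclause T)) -map_comp.
by case/flatten_mapP=> c _ /owner_clause_elts; case: u.
Qed.
(** * Stopping sets *)

Definition stops (V : Type) (p : pred V) (A : seq V) : bool := count p A != 1.

(** The hyperedge [{o, q}] makes [o] and [q] agree; once they do, [{u, v, o}] and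
    [{u, o, q}] say that [o] is the disjunction of [u] and [v].  The chain thus
    accumulates the disjunction of the premise. *)
Lemma chain_stops (T : choiceType) (p : pred (elt T)) c prev i A :
  all (stops p) (chain_edges c prev i A) <->
  (forall j, j < size A ->
     p (Oelt c (i + j)) = p prev || has (p \o @Var T) (take j.+1 A) /\
     p (Qelt c (i + j)) = p prev || has (p \o @Var T) (take j.+1 A)).
Proof.
elim: A prev i => [|a A IHA] prev i; first by split.
have -> : all (stops p) (chain_edges c prev i (a :: A)) =
    [&& p (Oelt c i) == p prev || p (Var a), p (Qelt c i) == p prev || p (Var a)
      & all (stops p) (chain_edges c (Oelt c i) i.+1 A)].
  rewrite /= /stops /= !andbA; congr (_ && _).
  by case: (p prev) (p (Var a)) (p (Oelt c i)) (p (Qelt c i)) => [] [] [] [].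
split=> [/and3P[/eqP Oi /eqP Qi /IHA chain] [_|j jA]|chain].
- by rewrite addn0 /= take0 /= orbF.
- by rewrite addnS -addSn [take _ _]/= [has _ _]/= orbA -Oi; apply: chain.
have := chain 0 isT; rewrite addn0 /= take0 /= orbF => -[Oi Qi].
rewrite Oi Qi !eqxx /=; apply/IHA => j jA.
by have := chain j.+1 jA; rewrite addnS -addSn /= orbA -Oi.
Qed.

(** The value that the hyperedges of [C] force on an element of [C], for the set
    [p] of variables. *)
Definition gate (T : Type) (p : pred T) (C : clause T) (u : elt T) : bool :=
  match u with
  | Oelt _ i | Qelt _ i => has p (take i (prem C))
  | QCelt _ => has p (prem C)
  | _ => false
  end.

(** The clause read off the set [p] of false variables: a false conclusion needs a
    false premise variable.  For the conclusion [bot], [r] stands for the membership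
    of the element of that name, and the hyperedge [{o_C, r}] gives an equivalence. *)
Definition refuted (T : Type) (r : bool) (p : pred T) (C : clause T) : bool :=
  if concl C is Some b then p b ==> has p (prem C) else has p (prem C) == r.

(** The output element is the disjunction of the premise by [chain_stops]; the last
    one or two hyperedges then compare it with the conclusion. *)
Lemma clause_stops (T : choiceType) (p : pred (elt T)) c C :
  all (stops p) (clause_edges c C) <->
  {in clause_elts c C, p =1 gate (p \o @Var T) C} /\
    refuted (p Relt) (p \o @Var T) C.
Proof.
rewrite /clause_edges /clause_elts all_cat.
set edges := (if prem C is a :: A then _ else _).
set elements := (if prem C is _ :: A then _ else _).
have premise_stops :
    all (stops p) edges <-> {in elements, p =1 gate (p \o @Var T) C}.
  rewrite /edges /elements /gate; case: (prem C) => [|a A].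
    rewrite /= /stops /= andbT addn0; split=> [p0 u|].
      by rewrite inE => /eqP->; case: (p _) p0.
    by move=> ->; rewrite ?mem_head.
  rewrite chain_stops; split=> [chain u|chain j jA].
    case/flatten_mapP=> i; rewrite mem_iota => /andP[i2 iA].
    have := chain (i - 2); rewrite subnKC // => -[|Oi Qi]; first by lia.
    have take_i : take i (a :: A) = a :: take (i - 2).+1 A.
      by rewrite -[in LHS](subnKC i2).
    have {}take_i : p (Var a) || has (p \o @Var T) (take (i - 2).+1 A)
      = has (p \o @Var T) (take i (a :: A)) by rewrite take_i.
    by rewrite !inE => /orP[]/eqP->; rewrite ?Oi ?Qi take_i.
  have ij : 2 + j \in iota 2 (size A) by rewrite mem_iota leq_addr ltn_add2l.
  by split; rewrite chain //; apply/flatten_mapP; exists (2 + j);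
     rewrite // !inE eqxx ?orbT.
have output_gate : {in elements, p =1 gate (p \o @Var T) C} ->
    p (output_elt c C) = has (p \o @Var T) (prem C).
  rewrite /elements /output_elt /gate; case: (prem C) => [|a [|a' A]].
  - by move=> ->; rewrite ?mem_head.
  - by rewrite /= orbF.
  - move=> ->; first by rewrite take_size.
    apply/flatten_mapP; exists (size A).+2; last exact: mem_head.
    by rewrite mem_iota /=; lia.
set p' := p \o @Var T in premise_stops output_gate *.
have split_elements : {in elements ++ (if concl C is Some _ then [:: QCelt c] else [::]),
      p =1 gate p' C} <->
    {in elements, p =1 gate p' C} /\
    (if concl C is Some _ then p (QCelt c) == has p' (prem C) else true) = true.
  case: (concl C) => [b|]; last by rewrite cats0; split=> [|[]].
  split=> [elts_p|[elts_p /eqP q_p] u].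
    split=> [u uE|]; first by apply: elts_p; rewrite mem_cat uE.
    by rewrite elts_p ?mem_cat ?inE ?eqxx ?orbT.
  by rewrite mem_cat inE => /orP[/elts_p //|/eqP->].
rewrite split_elements -premise_stops /refuted.
have conclusion_stops : all (stops p) edges ->
    all (stops p) (if concl C is Some b then [:: [:: output_elt c C; QCelt c];
                    [:: Var b; output_elt c C; QCelt c]]
                   else [:: [:: output_elt c C; Relt]]) =
    (if concl C is Some _ then p (QCelt c) == has p' (prem C) else true) &&
    (if concl C is Some b then p' b ==> has p' (prem C)
     else has p' (prem C) == p Relt).
  move=> /premise_stops/output_gate <-; rewrite /p' /stops.
  case: (concl C) => [b|] /=.
    by case: (p (Var b)) (p (QCelt c)) (p (output_elt c C)) => [] [] [].
  by case: (p Relt) (p (output_elt c C)) => [] [].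
split=> [/andP[pE]|[[pE q_p] ref]].
  by rewrite conclusion_stops // => /andP[q_p ref]; split=> //.
by rewrite pE conclusion_stops // q_p ref.
Qed.

Lemma flatten_indexed_all A B (d : A) (s : seq A) (F : nat * A -> seq B) (P : pred B) :
  all P (flatten (map F (indexed s))) <->
  (forall c, c < size s -> all P (F (c, nth d s c))).
Proof.
rewrite (indexedE d) -map_comp; elim: (size s) => [|n IHn] //.
rewrite -[n.+1]addn1 iotaD map_cat flatten_cat all_cat /= cats0 add0n.
split=> [/andP[/IHn all_lt all_n] c|all_le].
  by rewrite addn1 ltnS leq_eqVlt => /orP[/eqP-> //|/all_lt].
by rewrite all_le ?addn1 // andbT; apply/IHn => c cn; apply: all_le; rewrite addn1 ltnW.
Qed.

Lemma construction_stops (T : choiceType) (X : {fset T}) G (p : pred (elt T)) :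
  all (stops p) (construction X G) <->
  [/\ p Relt = p Rhoelt, {in X, forall x, p (Var x) -> p Relt} &
      forall c, c < size G ->
        {in clause_elts c (nth (noclause T) G c),
          p =1 gate (p \o @Var T) (nth (noclause T) G c)} /\
        refuted (p Relt) (p \o @Var T) (nth (noclause T) G c)].
Proof.
rewrite /construction [all _ _]/= all_cat.
have base : stops p [:: Relt; Rhoelt] = (p Relt == p Rhoelt).
  by rewrite /stops /=; case: (p Relt) (p Rhoelt) => [] [].
have vars : p Relt = p Rhoelt ->
    all (stops p) [seq [:: Var x; Relt; Rhoelt] | x <- enum_fset X] <->
    {in X, forall x, p (Var x) -> p Relt}.
  move=> Rho; rewrite all_map; split=> [/allP vars x /vars|vars].
    by rewrite /stops /= -Rho; case: (p (Var x)) (p Relt) => [] [].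
  apply/allP => x /vars; rewrite /stops /= -Rho.
  by case: (p (Var x)) (p Relt) => [] [] // ->.
rewrite base; split.
  case/and3P=> /eqP Rho /(vars Rho) pX /(flatten_indexed_all (noclause T)) pG.
  by split=> // c /pG/clause_stops.
case=> Rho /(vars Rho) pX pG; rewrite Rho eqxx pX /=.
by apply/(flatten_indexed_all (noclause T)) => c /pG/clause_stops.
Qed.
(** * Stopping sets and models *)
Local Open Scope fset_scope.

Lemma mem_Stop (T : choiceType) (V S : {fset T}) H :
  all uniq H -> (S \in Stop V H) = (S `<=` V) && all (stops (mem S)) H.
Proof.
move=> H_uniq; rewrite !inE fpowersetE; congr (_ && _).
apply: eq_in_all => A /(allP H_uniq) A_uniq; rewrite /stops; congr (_ != _).
rewrite -size_filter; apply/perm_size/uniq_perm; rewrite ?fset_uniq ?filter_uniq //.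
by move=> v; rewrite mem_filter !inE andbC.
Qed.

Lemma mem_Mod (T : choiceType) (X M : {fset T}) G :
  (M \in Mod X G) = (M `<=` X) && all (sat M) G.
Proof. by rewrite !inE fpowersetE. Qed.

Lemma all_flatten_seq T (P : pred T) ss : all P (flatten ss) = all (all P) ss.
Proof. by elim: ss => //= s ss IH; rewrite all_cat IH. Qed.

(** [(A \ v) -> v] fails in [K] exactly when [v] is the only element of [A] outside
    [K], that is, when the complement of [K] meets [A] in one element. *)
Lemma sat_Phi (T : choiceType) (K : {fset T}) H :
  all uniq H -> all (sat K) (Phi H) = all (stops (predC (mem K))) H.
Proof.
move=> H_uniq; rewrite /Phi all_flatten_seq all_map; apply: eq_in_all => A.
move=> /(allP H_uniq) A_uniq /=; rewrite all_map /stops -size_filter.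
set out := filter _ A; apply/allP/idP => [A_sat|out_neq1 v vA].
  apply/negP; case def_out: out => [|v [|]] // _.
  have : v \in out by rewrite def_out mem_head.
  rewrite mem_filter /= => /andP[vK vA].
  have := A_sat v vA; rewrite /= /sat /= (negPf vK) implybF => /negP[].
  apply/allP => u; rewrite mem_filter => /andP[uv uA] /=.
  apply: contraR uv => uK; have : u \in out by rewrite mem_filter /= uK.
  by rewrite def_out inE.
apply/implyP => /= /allP others; apply: contraR out_neq1 => vK.
rewrite -[1]/(size [:: v]); apply/eqP/perm_size/uniq_perm => //.
  exact: filter_uniq.
move=> u; rewrite mem_filter inE /=; apply/andP/eqP => [[uK uA]|-> //].
by apply/eqP; apply: contraNT uK => uv; apply: others; rewrite mem_filter uv.
Qed.

Lemma mem_proper_models (T : choiceType) (V K : {fset T}) H :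
  all uniq H -> all (all (mem V)) H -> K `<=` V ->
  (K \in proper_models V H) = (V `\` K \in Stop V H `\ fset0).
Proof.
move=> H_uniq HV KV; rewrite /proper_models !in_fsetD1 mem_Mod mem_Stop // KV.
rewrite fsubsetDl sat_Phi //=; congr (_ && _).
  by rewrite fsetD_eq0 eqEfsubset KV.
apply: eq_in_all => A /(allP HV)/allP AV; rewrite /stops; congr (_ != _).
by apply: eq_in_count => v /AV /= vV; rewrite /= in_fsetD vV andbT.
Qed.

Lemma in_eta_gate (T : choiceType) (G : cnf T) (S : {fset T}) c u :
  owner u = Some c -> in_eta G S u = gate (mem S) (nth (noclause T) G c) u.
Proof.
case: u => //= [? i|? i|_] [->] //; rewrite /in_eta0 /output_elt.
by case E: (prem _) => [|a [|a' A]] /=; rewrite ?orbF ?E /= ?take_size.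
Qed.

Lemma sat_setD (T : choiceType) (X R : {fset T}) C :
  horn_clause X C -> sat (X `\` R) C = refuted true (mem R) C.
Proof.
case/andP=> /allP premX conclX; rewrite /sat /refuted.
have -> : all (mem (X `\` R)) (prem C) = ~~ has (mem R) (prem C).
  rewrite -all_predC; apply: eq_in_all => a /premX aX.
  by rewrite /= in_fsetD andbC; move: aX => /= ->.
case: (concl C) conclX => [b /andP[bX _]|_]; last by rewrite implybF negbK eqb_id.
by rewrite in_fsetD bX andbT implybNN.
Qed.

Lemma mem_False (T : choiceType) (X S : {fset T}) G :
  horn_cnf X G ->
  (S \in False_ X G) = (S `<=` X) && all (refuted true (mem S)) G.
Proof.
move=> G_horn.
have sat_refuted R : all (sat (X `\` R)) G = all (refuted true (mem R)) G.
  by elim: G G_horn => //= C G IHG /andP[CX /IHG->]; rewrite sat_setD.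
apply/imfsetP/andP => [[M /=]|[SX G_ref]].
  rewrite mem_Mod => /andP[MX satM] ->; split; first exact: fsubsetDl.
  by rewrite -sat_refuted fsetDK.
exists (X `\` S); last by rewrite fsetDK.
by rewrite mem_Mod fsubsetDl sat_refuted.
Qed.

Lemma mem_U (T : choiceType) (X : {fset T}) G u : (u \in U X G) = (u \in elts X G).
Proof. by rewrite in_fset. Qed.

Lemma mem_eta (T : choiceType) (X S : {fset T}) G u :
  (u \in eta_map X G S) = (u \in elts X G) && in_eta G S u.
Proof. by rewrite in_fset /= inE mem_U. Qed.

Lemma mem_trace (T : choiceType) (X : {fset T}) (R : {fset elt T}) x :
  (x \in trace X R) = (x \in X) && (Var x \in R).
Proof. by rewrite !inE. Qed.

Lemma trace_eta (T : choiceType) (X S : {fset T}) G :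
  S `<=` X -> trace X (eta_map X G S) = S.
Proof.
move=> SX; apply/fsetP => x; rewrite mem_trace mem_eta mem_elts /=.
by have [xS|] := boolP (x \in S); rewrite ?andbF // (fsubsetP SX).
Qed.

Lemma nth_horn (T : choiceType) (X : {fset T}) G c :
  horn_cnf X G -> c < size G -> horn_clause X (nth (noclause T) G c).
Proof. by move=> /(all_nthP (noclause T)); apply. Qed.

(** If [r] is missing, then so are [rho] and, by the hyperedges [{x, r, rho}], all
    variables, hence also all gates: a nonempty stopping set contains [r] and
    [rho].  All other elements are given by [clause_stops]. *)
Lemma stop_trace (T : choiceType) (X : {fset T}) G (R : {fset elt T}) :
  horn_cnf X G -> R `<=` U X G -> all (stops (mem R)) (construction X G) ->
  R <> fset0 ->
  R = eta_map X G (trace X R) /\ trace X R \in False_ X G.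
Proof.
move=> G_horn RU /construction_stops[Rho RX RG] R_neq0.
have trace_prem c : c < size G ->
    {in prem (nth (noclause T) G c), mem R \o @Var T =1 mem (trace X R)}.
  by move=> /(nth_horn G_horn)/andP[/allP premX _] a /premX /= aX; rewrite mem_trace aX.
have R_eta u c : owner u = Some c -> u \in U X G ->
    (u \in R) = in_eta G (trace X R) u.
  move=> uc; rewrite mem_U mem_elts => uU; rewrite (in_eta_gate _ _ uc).
  have [cG uC] : c < size G /\ u \in clause_elts c (nth (noclause T) G c).
    by case: u uc uU => // [? i|? i|?] [->] /andP[].
  have [gates _] := RG c cG; rewrite -[u \in R]/((mem R) u) gates //.
  case: u {uc uU uC} => //= *; apply: eq_in_has; try exact: trace_prem.
    by move=> a /mem_take; apply: trace_prem.
  by move=> a /mem_take; apply: trace_prem.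
have Relt_in : Relt \in R.
  apply: contra_notT R_neq0 => R_out.
  have no_var x : Var x \notin R.
    apply: contra R_out => xR; apply: (RX x) => //.
    by have := fsubsetP RU _ xR; rewrite mem_U mem_elts.
  have trace0 : trace X R = fset0.
    by apply/fsetP => x; rewrite !inE (negPf (no_var x)) andbF.
  have no_gate u c : owner u = Some c -> u \notin R.
    move=> uc; apply/negP => uR; move: (uR).
    rewrite (R_eta u c) // ?(fsubsetP RU) // trace0 (in_eta_gate _ _ uc).
    have no_has s : has (mem (fset0 : {fset T})) s = false by elim: s.
    by case: u {uc uR} => //= [? i|? i|?]; rewrite no_has.
  apply/fsetP => u; rewrite in_fset0; apply/negbTE.
  by case: u => [x|c i|c i|c||]; rewrite ?(no_gate _ c) // -[_ \in _]Rho.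
split.
  apply/fsetP => u; rewrite mem_eta; have [uU|uU] := boolP (u \in elts X G); last first.
    by apply: contraNF uU => /(fsubsetP RU); rewrite mem_U.
  case: u uU => [x|c i|c i|c||] uU.
  - by rewrite mem_elts in uU; rewrite /= mem_trace uU.
  - by rewrite (R_eta _ c) ?mem_U.
  - by rewrite (R_eta _ c) ?mem_U.
  - by rewrite (R_eta _ c) ?mem_U.
  - by rewrite Relt_in.
  - by rewrite -[_ \in _]Rho /= Relt_in.
rewrite mem_False //; apply/andP; split.
  by apply/fsubsetP => x; rewrite mem_trace => /andP[].
apply/(all_nthP (noclause T)) => c cG.
have [_] := RG c cG; rewrite /refuted /= Relt_in.
rewrite (eq_in_has (trace_prem c cG)).
move: (nth_horn G_horn cG) => /andP[_].
by case: (concl _) => // b /andP[bX _]; rewrite /= mem_trace bX.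
Qed.

Lemma eta_stops (T : choiceType) (X S : {fset T}) G :
  horn_cnf X G -> S \in False_ X G ->
  all (stops (mem (eta_map X G S))) (construction X G).
Proof.
move=> G_horn; rewrite mem_False // => /andP[SX G_ref].
have eta_elts u : u \in elts X G -> (u \in eta_map X G S) = in_eta G S u.
  by move=> uU; rewrite mem_eta uU.
have eta_Relt : Relt \in eta_map X G S by rewrite eta_elts ?mem_elts.
have eta_prem c : c < size G ->
    {in prem (nth (noclause T) G c), mem (eta_map X G S) \o @Var T =1 mem S}.
  move=> /(nth_horn G_horn)/andP[/allP premX _] a /premX /= aX.
  by rewrite eta_elts ?mem_elts.
apply/construction_stops; split=> [||c cG].
- by rewrite /= !eta_elts ?mem_elts.
- by [].
split=> [u uC|].
  have uc := owner_clause_elts uC.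
  rewrite /= eta_elts ?(in_eta_gate _ _ uc); last first.
    by rewrite mem_elts; case: u uc uC => // [? i|? i|?] [->] ->; rewrite cG.
  case: u {uc uC} => //= *; apply/esym/eq_in_has; try exact: eta_prem.
    by move=> a /mem_take; apply: eta_prem.
  by move=> a /mem_take; apply: eta_prem.
have := all_nthP (noclause T) G_ref c cG.
rewrite /refuted /= eta_Relt (eq_in_has (eta_prem c cG)).
move: (nth_horn G_horn cG) => /andP[_].
by case: (concl _) => // b /andP[bX _]; rewrite /= eta_elts ?mem_elts.
Qed.

Lemma eta_map_mono (T : choiceType) (X S S' : {fset T}) G :
  S `<=` S' -> eta_map X G S `<=` eta_map X G S'.
Proof.
move=> /fsubsetP SS'; apply/fsubsetP => u; rewrite !mem_eta => /andP[-> /=].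
have mono0 v : in_eta0 G S v -> in_eta0 G S' v.
  by case: v => //= c i; apply: sub_has => x; apply: SS'.
by case: u => [x|c i|c i|c||]; apply: mono0.
Qed.

Lemma trace_mono (T : choiceType) (X : {fset T}) (R R' : {fset elt T}) :
  R `<=` R' -> trace X R `<=` trace X R'.
Proof.
move=> /fsubsetP RR'; apply/fsubsetP => x; rewrite !mem_trace => /andP[-> /=].
exact: RR'.
Qed.

Lemma fsubsetDD (T : choiceType) (V A B : {fset T}) :
  A `<=` V -> B `<=` V -> (V `\` A `<=` V `\` B) = (B `<=` A).
Proof.
move=> AV BV; apply/idP/idP => [/(fsetDS V)|]; last exact: fsetDS.
by rewrite !fsetDK.
Qed.

Lemma trace_setD (T : choiceType) (X : {fset T}) G (K : {fset elt T}) :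
  trace X (U X G `\` K) = X `\` trace X K.
Proof.
apply/fsetP => x; rewrite mem_trace !in_fsetD mem_trace mem_U mem_elts.
by case: (x \in X); rewrite ?andbF ?andbT.
Qed.

Lemma eta_map_sub (T : choiceType) (X S : {fset T}) G : eta_map X G S `<=` U X G.
Proof. by apply/fsubsetP => u; rewrite mem_eta mem_U => /andP[]. Qed.

Lemma trace_sub (T : choiceType) (X : {fset T}) (K : {fset elt T}) :
  trace X K `<=` X.
Proof. by apply/fsubsetP => x; rewrite mem_trace => /andP[]. Qed.

Lemma eta_iso (T : choiceType) (X : {fset T}) G :
  horn_cnf X G -> all uniq (construction X G) ->
  incl_iso (False_ X G) (Stop (U X G) (construction X G) `\ fset0)
    (eta_map X G) (trace X).
Proof.
move=> G_horn CG_uniq.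
have False_sub S : S \in False_ X G -> S `<=` X by rewrite mem_False // => /andP[].
have stopP R : R \in Stop (U X G) (construction X G) `\ fset0 ->
    R = eta_map X G (trace X R) /\ trace X R \in False_ X G.
  rewrite in_fsetD1 mem_Stop // => /and3P[/eqP R0 RU R_stops].
  exact: stop_trace.
split.
- move=> S SF; rewrite in_fsetD1 mem_Stop // eta_map_sub eta_stops // !andbT.
  by apply/eqP => /fsetP/(_ Relt); rewrite mem_eta mem_elts.
- by move=> R /stopP[].
- by move=> S /False_sub; apply: trace_eta.
- by move=> R /stopP[<-].
- move=> S S' /False_sub SX /False_sub SX'; apply/idP/idP.
    by move/(trace_mono X); rewrite !trace_eta.
  exact: eta_map_mono.
Qed.

(** Conjugating [eta_iso] by the complements in [X] and in the ground set, which
    both reverse inclusion. *)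
Lemma etahat_iso (T : choiceType) (X : {fset T}) G :
  horn_cnf X G -> all uniq (construction X G) ->
  hypergraph_on (U X G) (construction X G) ->
  incl_iso (Mod X G) (proper_models (U X G) (construction X G))
    (etahat_map X G) (trace X).
Proof.
move=> G_horn CG_uniq CG_on.
have [etaP traceP etaK traceK eta_mono] := eta_iso G_horn CG_uniq.
have Mod_sub M : M \in Mod X G -> M `<=` X by rewrite mem_Mod => /andP[].
have Mod_False M : M \in Mod X G -> X `\` M \in False_ X G by move=> MG; apply: in_imfset.
have proper_sub K : K \in proper_models (U X G) (construction X G) -> K `<=` U X G.
  by rewrite in_fsetD1 mem_Mod => /and3P[].
split.
- move=> M /Mod_False/etaP; rewrite mem_proper_models ?fsubsetDl //.
  by rewrite fsetDK ?eta_map_sub.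
- move=> K KP; have KU := proper_sub K KP; move: KP.
  rewrite mem_proper_models // => /traceP; rewrite trace_setD.
  case/imfsetP=> M /= MG XK; rewrite -(fsetDK (trace_sub X K)) XK.
  by rewrite fsetDK // Mod_sub.
- move=> M MG; rewrite trace_setD trace_eta ?fsubsetDl // fsetDK //.
  exact: Mod_sub.
- move=> K KP; have KU := proper_sub K KP; move: KP.
  rewrite mem_proper_models // => /traceK; rewrite trace_setD /etahat_map => ->.
  by rewrite fsetDK.
- move=> M M' MG MG'; rewrite fsubsetDD ?eta_map_sub //.
  by rewrite eta_mono ?Mod_False // fsubsetDD ?Mod_sub.
Qed.

Lemma incl_iso_max (T T' : choiceType) (F : {fset {fset T}}) (F' : {fset {fset T'}}) f g :
  incl_iso F F' f g -> bij_between (incl_max F) (incl_max F') f.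
Proof.
case=> fP gP fK gK f_mono.
have maxP (V : choiceType) (E : {fset {fset V}}) M :
    reflect (M \in E /\ {in E, forall N, M `<=` N -> N = M}) (M \in incl_max E).
  rewrite in_fset /= inE; apply: (iffP andP) => -[ME M_max]; split=> //.
    by move=> N NE /(implyP (allP M_max N NE))/eqP.
  by apply/allP => N NE; apply/implyP => /M_max ->.
split.
- move=> M /maxP[MF M_max]; apply/maxP; split; first exact: fP.
  by move=> N NF; rewrite -(gK N NF) f_mono ?gP // => /(M_max _ (gP _ NF)) ->.
- by move=> M N /maxP[MF _] /maxP[NF _] fMN; rewrite -(fK M MF) fMN fK.
- move=> N /maxP[NF N_max]; exists (g N); last by rewrite gK.
  apply/maxP; split; first exact: gP.
  move=> M MF; rewrite -f_mono ?gP // gK // => /(N_max _ (fP _ MF)) <-.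
  by rewrite fK.
Qed.

(** * The hyperedges *)

Lemma chain_edges_all (T : choiceType) (P : pred (elt T)) c prev i A :
  P prev -> all (P \o @Var T) A ->
  (forall j, i <= j < i + size A -> P (Oelt c j) && P (Qelt c j)) ->
  all (all P) (chain_edges c prev i A).
Proof.
elim: A prev i => //= a A IHA prev i Pprev /andP[Pa PA] Pchain.
have /andP[PO PQ] := Pchain i ltac:(lia).
rewrite Pprev Pa PO PQ /=; apply: IHA => // j jA; apply: Pchain; lia.
Qed.

Lemma output_eltP (T : choiceType) c (C : clause T) :
  output_elt c C \in [seq Var a | a <- prem C] ++ clause_elts c C.
Proof.
rewrite /output_elt /clause_elts mem_cat mem_cat.
case: (prem C) => [|a [|a' A]]; rewrite ?mem_head ?orbT //.
apply/orP; right; apply/orP; left; apply/flatten_mapP; exists (size A).+2.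
  by rewrite mem_iota /=; lia.
exact: mem_head.
Qed.

Lemma clause_edges_all (T : choiceType) (P : pred (elt T)) c C :
  all (P \o @Var T) (prem C) ->
  (if concl C is Some b then P (Var b) else P Relt) ->
  all P (clause_elts c C) -> all (all P) (clause_edges c C).
Proof.
move=> Pprem Pconcl /allP Pelts.
have Pout : P (output_elt c C).
  have := output_eltP c C; rewrite mem_cat => /orP[/mapP[a aC ->]|/Pelts //].
  exact: (allP Pprem).
rewrite /clause_edges all_cat; apply/andP; split; last first.
  move: Pconcl Pelts; rewrite /clause_elts; case: (concl C) => [b|] /= Pb Pelts.
    by rewrite Pb Pout Pelts // mem_cat mem_head orbT.
  by rewrite Pout Pb.
move: Pprem Pelts; rewrite /clause_elts; case: (prem C) => [_|a A /= /andP[Pa PA]] Pelts.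
  by rewrite /= Pelts // mem_head.
apply: chain_edges_all => // j jA.
by apply/andP; split; apply: Pelts; rewrite mem_cat; apply/orP; left;
   apply/flatten_mapP; exists j; rewrite ?mem_iota // !inE eqxx ?orbT.
Qed.

Lemma construction_on (T : choiceType) (X : {fset T}) G :
  horn_cnf X G -> hypergraph_on (U X G) (construction X G).
Proof.
move=> G_horn; rewrite /hypergraph_on /construction /= all_cat !mem_U !mem_elts /=.
apply/andP; split.
  rewrite all_map; apply/allP => x xX /=.
  by rewrite !mem_U !mem_elts xX.
apply/(flatten_indexed_all (noclause T)) => c cG /=.
have /andP[/allP premX conclX] := nth_horn G_horn cG.
apply: clause_edges_all.
- by apply/allP => a /premX aX; rewrite /= mem_U mem_elts.
- by case: (concl _) conclX => [b /andP[bX _]|_] /=; rewrite mem_U mem_elts.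
apply/allP => u uC; rewrite /= mem_U mem_elts.
have uc := owner_clause_elts uC; by case: u uc uC => // [? i|? i|?] [->] ->; rewrite cG.
Qed.

Lemma chain_edges_size (T : choiceType) c (prev : elt T) i A :
  all (fun e => 0 < size e <= 3) (chain_edges c prev i A).
Proof. by elim: A prev i => //= a A IHA prev i; rewrite IHA. Qed.

Lemma construction_edge_size (T : choiceType) (X : {fset T}) G :
  all (fun e => 0 < size e <= 3) (construction X G).
Proof.
rewrite /construction /= all_cat all_map; apply/andP; split; first exact/allP.
apply/(flatten_indexed_all (noclause T)) => c _ /=.
rewrite /clause_edges all_cat; apply/andP; split.
  by case: (prem _) => [|a A] //; apply: chain_edges_size.
by case: (concl _).
Qed.

(** The elements that may be the first input of the gate [o_i]. *)
Definition before T (i : nat) (u : elt T) : bool :=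
  match u with Var _ => true | Oelt _ j => j < i | _ => false end.

Lemma chain_edges_uniq (T : choiceType) c (prev : elt T) i A :
  before i prev -> prev \notin [seq Var a | a <- A] ->
  all uniq (chain_edges c prev i A).
Proof.
elim: A prev i => [//|a A IHA] prev i i_prev.
rewrite [map _ _]/= inE negb_or => /andP[prev_a _].
have prev_O : prev != Oelt c i by apply: contraTneq i_prev => -> /=; rewrite ltnn.
have prev_Q : prev != Qelt c i by apply: contraTneq i_prev => ->.
have later_uniq : all uniq (chain_edges c (Oelt c i) i.+1 A).
  by apply: IHA => /=; [rewrite ltnS | apply/negP => /mapP[]].
rewrite /chain_edges -/(chain_edges _ _ _ _) all_cat later_uniq.
by rewrite /all /uniq !inE !negb_or prev_a prev_O prev_Q.
Qed.

Lemma output_notin (T : choiceType) c (C : clause T) b :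
  b \notin prem C -> Var b != output_elt c C.
Proof.
move=> bC; apply: contra bC => /eqP b_out; have := output_eltP c C.
rewrite -b_out mem_cat => /orP[|/owner_clause_elts //].
by rewrite mem_map // => ? ? [].
Qed.

Lemma output_new (T : choiceType) c (C : clause T) u :
  u \in [:: QCelt c; Relt] -> output_elt c C != u.
Proof.
by rewrite !inE /output_elt; case: (prem C) => [|a [|a' A]] /orP[]/eqP->.
Qed.

Lemma construction_uniq (T : choiceType) (X : {fset T}) G :
  horn_cnf X G -> all (fun C => uniq (prem C)) G -> all uniq (construction X G).
Proof.
move=> G_horn G_uniq; rewrite /construction /= all_cat all_map; apply/andP; split.
  exact/allP.
apply/(flatten_indexed_all (noclause T)) => c cG /=.
have := all_nthP (noclause T) G_uniq c cG.
have /andP[_] := nth_horn G_horn cG.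
move: (nth _ _ _) => C conclC premC.
rewrite /clause_edges all_cat; apply/andP; split.
  case: (prem C) premC => [|a A] //= /andP[aA _]; apply: chain_edges_uniq => //.
  by rewrite mem_map // => ? ? [].
case: (concl C) conclC => [b /andP[_ bC]|_] /=.
  by rewrite !inE (negPf (output_notin c bC)) output_new ?mem_head.
by rewrite !inE output_new ?inE ?orbT.
Qed.

Local Notation vertices e := [fset v in e].

Lemma eq_fset_seq (T : choiceType) (e e' : seq T) :
  [fset v in e] = [fset v in e'] -> e =i e'.
Proof. by move=> /fsetP ee' v; have := ee' v; rewrite !inE. Qed.

(** The test [p] tells the hyperedges of [E'] from those of [E] by their elements,
    regardless of the order in which these are listed. *)
Lemma uniq_vertices_cat (T : choiceType) (p : pred T) (E E' : seq (seq T)) :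
  all (all (predC p)) E -> all (has p) E' ->
  uniq [seq vertices e | e <- E] -> uniq [seq vertices e | e <- E'] ->
  uniq [seq vertices e | e <- E ++ E'].
Proof.
move=> /allP E_p /allP E'_p E_uniq E'_uniq; rewrite map_cat cat_uniq E_uniq E'_uniq andbT.
apply/hasPn => _ /mapP[e' /E'_p e'p ->]; apply/mapP => -[e /E_p].
by rewrite all_predC => /negP ep /eq_fset_seq/eq_has_r ee'; rewrite -ee' in ep.
Qed.

Definition later_output T (i : nat) (u : elt T) : bool :=
  if u is Oelt _ j then i <= j else false.

Lemma chain_edges_later (T : choiceType) c (prev : elt T) i k A :
  k <= i -> all (has (later_output k)) (chain_edges c prev i A).
Proof.
elim: A prev i => //= a A IHA prev i ki.
by rewrite ki !orbT IHA // ltnW.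
Qed.

(** The three hyperedges of step [i] are told from those of later steps by the
    absence of [o_j] with [j > i]. *)
Lemma chain_edges_distinct (T : choiceType) c (prev : elt T) i A :
  before i prev -> uniq [seq vertices e | e <- chain_edges c prev i A].
Proof.
elim: A prev i => // a A IHA prev i i_prev.
apply: (@uniq_vertices_cat _ (later_output i.+1)
  [:: [:: Oelt c i; Qelt c i]; [:: prev; Var a; Oelt c i]; [:: prev; Oelt c i; Qelt c i]]
  (chain_edges c (Oelt c i) i.+1 A)).
- rewrite /= !ltnn /=; have -> : ~~ later_output i.+1 prev.
    by case: prev i_prev => //= _ j ji; rewrite -leqNgt ltnW.
  by [].
- exact: chain_edges_later.
- have prev_O : prev != Oelt c i by apply: contraTneq i_prev => -> /=; rewrite ltnn.
  have prev_Q : prev != Qelt c i by apply: contraTneq i_prev => ->.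
  rewrite /= !inE andbT negb_or -andbA; apply/and3P; split.
  + apply/eqP => /eq_fset_seq/(_ (Qelt c i)); rewrite !inE eqxx orbT.
    by rewrite eq_sym (negPf prev_Q).
  + apply/eqP => /eq_fset_seq/(_ prev); rewrite !inE eqxx.
    by rewrite (negPf prev_O) (negPf prev_Q).
  + apply/eqP => /eq_fset_seq/(_ (Qelt c i)); rewrite !inE eqxx !orbT.
    by rewrite eq_sym (negPf prev_Q).
- by apply: IHA => /=.
Qed.

Definition concluding T (u : elt T) : bool :=
  match u with QCelt _ | Relt => true | _ => false end.

Lemma clause_edges_distinct (T : choiceType) c (C : clause T) :
  (if concl C is Some b then b \notin prem C else true) ->
  uniq [seq vertices e | e <- clause_edges c C].
Proof.
move=> conclC; apply: (@uniq_vertices_cat _ (@concluding T)).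
- case: (prem C) => [|a A] //; apply: chain_edges_all => //.
  by apply/allP.
- by case: (concl C) => //= *; rewrite ?orbT.
- by case: (prem C) => [|a A] //; apply: chain_edges_distinct.
case: (concl C) conclC => // b bC; rewrite /= !inE andbT.
apply/eqP => /eq_fset_seq/(_ (Var b)); rewrite !inE eqxx.
by rewrite (negPf (output_notin c bC)).
Qed.

(** The exceptional hyperedges are those of the clauses [a -> bot].  They are the
    only place where the distinctness of the clauses matters: two clauses with
    the same variable [a] would produce the same hyperedge. *)
Lemma clause_edges_owned (T : choiceType) c (C : clause T) e :
  e \in clause_edges c C ->
  has (fun u => owner u == Some c) e \/
  exists a, [/\ prem C = [:: a], concl C = None & e = [:: Var a; Relt]].
Proof.
rewrite /clause_edges mem_cat => /orP[eC|].
  left; case: (prem C) eC => [|a A]; first by rewrite inE => /eqP-> /=; rewrite eqxx.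
  elim: A (Var a) 2 => //= a' A IHA prev i; rewrite !inE.
  by case/or4P=> [/eqP->|/eqP->|/eqP->|/IHA //] /=; rewrite eqxx ?orbT.
case: (concl C) => [b|].
  by rewrite !inE => /orP[]/eqP->; left; rewrite /= eqxx !orbT.
rewrite inE => /eqP->; rewrite /output_elt.
by case: (prem C) => [|a [|a' A]]; [left|right; exists a|left]; rewrite /= ?eqxx.
Qed.

Lemma clause_edges_owner (T : choiceType) c d (C : clause T) e u :
  e \in clause_edges c C -> u \in e -> owner u = Some d -> d = c.
Proof.
have owned : all (all (fun u => owner u \in [:: None; Some c])) (clause_edges c C).
  apply: clause_edges_all; first exact/allP.
    by case: (concl C).
  by apply/allP => v /owner_clause_elts ->; rewrite !inE eqxx.
move=> /(allP owned)/allP eP /eP /[swap] ->.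
by rewrite !inE /= => /eqP[].
Qed.

Lemma construction_distinct (T : choiceType) (X : {fset T}) G :
  horn_cnf X G -> normalized_cnf G ->
  uniq [seq vertices e | e <- construction X G].
Proof.
move=> G_horn /andP[_ G_norm].
have clauses_uniq :
    uniq [seq vertices e | e <- flatten [seq clause_edges cC.1 cC.2 | cC <- indexed G]].
  rewrite (indexedE (noclause T)) -map_comp map_flatten -map_comp.
  apply: uniq_flatten_map; first exact: iota_uniq.
    move=> c; rewrite mem_iota /= => cG; apply: clause_edges_distinct.
    by have /andP[_] := nth_horn G_horn cG; case: (concl _) => // b /andP[].
  move=> c d; rewrite !mem_iota /= => cG dG _
    /mapP[e ec ->] /mapP[e' ed /eq_fset_seq ee'].
  have [/hasP[u ue /eqP uc]|[a [prem_a concl_a def_e]]] := clause_edges_owned ec.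
    by apply: (clause_edges_owner ed _ uc); rewrite -ee'.
  have [/hasP[u ue /eqP ud]|[a' [prem_a' concl_a' def_e']]] := clause_edges_owned ed.
    by apply/esym/(clause_edges_owner ec _ ud); rewrite ee'.
  have aa' : a = a'.
    by have := ee' (Var a); rewrite def_e def_e' !inE eqxx /= orbF => /esym/eqP[].
  apply/eqP; rewrite -(nth_uniq ([fset x in [::]], None) _ _ G_norm) ?size_map //.
  by rewrite !(nth_map (noclause T)) // prem_a prem_a' concl_a concl_a' aa'.
have -> : construction X G =
    ([:: Relt; Rhoelt] :: [seq [:: Var x; Relt; Rhoelt] | x <- enum_fset X]) ++
    flatten [seq clause_edges cC.1 cC.2 | cC <- indexed G] by [].
rewrite map_cat uniq_catC -map_cat; apply: (@uniq_vertices_cat _ (pred1 Rhoelt)) => //.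
- apply/(flatten_indexed_all (noclause T)) => c cG /=; apply: clause_edges_all.
  + exact/allP.
  + by case: (concl _).
  + by apply/allP => u /owner_clause_elts uc /=; apply: contra_eqN uc => /eqP->.
- by rewrite /= all_map; apply/allP.
rewrite /= -map_comp map_inj_uniq ?fset_uniq ?andbT.
  by apply/mapP => -[x _ /eq_fset_seq/(_ (Var x))]; rewrite !inE eqxx.
by move=> x y /eq_fset_seq/(_ (Var x)); rewrite !inE eqxx /= orbF => /esym/eqP[].
Qed.

Local Close Scope fset_scope.

(** * Encodings *)

(** Variables are replaced with their positions in the enumeration of [X], which
    is all that the programs see of a clause. *)
Definition number (T : choiceType) (X : {fset T}) (C : clause T) : clause nat :=
  Clause [seq index x (enum_fset X) | x <- prem C]
    (omap (index^~ (enum_fset X)) (concl C)).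

Lemma encode_cnfE (T : choiceType) (X : {fset T}) G :
  encode_cnf X G =
  [:: #|` X|, size (map (number X) G) & cnf_code (map (number X) G)].
Proof.
rewrite /encode_cnf /cnf_code size_map -map_comp; congr [:: _, _ & flatten _].
apply: eq_map => C; rewrite /encode_clause /clause_code /= size_map.
by case: (concl C).
Qed.

Lemma index_mid (V : eqType) (s s' : seq V) u :
  uniq (s ++ u :: s') -> index u (s ++ u :: s') = size s.
Proof.
rewrite cat_uniq /= negb_or => /and3P[_ /andP[us _] _].
by rewrite index_cat (negPf us) /= eqxx addn0.
Qed.

Lemma map_index_self (V : eqType) (s : seq V) :
  uniq s -> [seq index v s | v <- s] = iota 0 (size s).
Proof.
case: s => // v0 s s_uniq; apply: (@eq_from_nth _ 0); first by rewrite size_map size_iota.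
by move=> i; rewrite size_map => i_s; rewrite (nth_map v0) // nth_iota // index_uniq.
Qed.

Definition edges_code (V : eqType) (vs : seq V) (E : seq (seq V)) : seq nat :=
  flatten [seq size e :: [seq index v vs | v <- e] | e <- E].

Lemma edges_code_cat (V : eqType) (vs : seq V) E E' :
  edges_code vs (E ++ E') = edges_code vs E ++ edges_code vs E'.
Proof. by rewrite /edges_code map_cat flatten_cat. Qed.

Definition chain_last T c (prev : elt T) i (A : seq T) : elt T :=
  if A is [::] then prev else Oelt c (i + size A).-1.

(** If the ground set lists the elements [s] first, then the next two elements get
    the numbers [size s] and [(size s).+1]. *)
Lemma chain_edges_codeE (T : choiceType) vs c (prev : elt T) i A s s' :
  uniq vs ->
  vs = s ++ flatten [seq [:: Oelt c j; Qelt c j] | j <- iota i (size A)] ++ s' ->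
  edges_code vs (chain_edges c prev i A) =
    chain_code (index prev vs) (size s) [seq index (Var a) vs | a <- A] /\
  index (chain_last c prev i A) vs =
    chain_out (index prev vs) (size s) [seq index (Var a) vs | a <- A].
Proof.
move=> vs_uniq; elim: A prev i s => [//|a A IHA] prev i s def_vs.
have O_index : index (Oelt c i) vs = size s by rewrite def_vs index_mid // -def_vs.
have def_vs' : vs = (s ++ [:: Oelt c i]) ++ Qelt c i ::
    flatten [seq [:: Oelt c j; Qelt c j] | j <- iota i.+1 (size A)] ++ s'.
  by rewrite def_vs -!catA.
have Q_index : index (Qelt c i) vs = (size s).+1.
  by rewrite [in LHS]def_vs' index_mid -?def_vs' // size_cat addn1.
have def_vs'' : vs = (s ++ [:: Oelt c i; Qelt c i]) ++
    flatten [seq [:: Oelt c j; Qelt c j] | j <- iota i.+1 (size A)] ++ s'.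
  by rewrite def_vs -!catA.
have [] := IHA (Oelt c i) i.+1 _ def_vs''.
rewrite size_cat addn2 O_index => codeA outA; split; last first.
  rewrite [RHS]/= -outA; congr index.
  by rewrite /chain_last; case: (A) => [|? ?]; rewrite /= ?addn1 // -addSnnS.
by rewrite /= -codeA /edges_code /= O_index Q_index.
Qed.

Lemma clause_edges_codeE (T : choiceType) vs c (C : clause T) s s' :
  uniq vs -> vs = s ++ clause_elts c C ++ s' ->
  edges_code vs (clause_edges c C) =
  clause_edges_code (index Relt vs) (size s)
    (Clause [seq index (Var a) vs | a <- prem C]
            (omap (fun b => index (Var b) vs) (concl C))).
Proof.
move=> vs_uniq; rewrite /clause_elts -catA => def_vs.
have [prem_code out_code] :
    edges_code vs (if prem C is a :: A then chain_edges c (Var a) 2 A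
                   else [:: [:: Oelt c 0]])
    = (if [seq index (Var a) vs | a <- prem C] is a :: A
       then chain_code a (size s) A else [:: 1; size s]) /\
    index (output_elt c C) vs
    = (if [seq index (Var a) vs | a <- prem C] is a :: A
       then chain_out a (size s) A else size s).
  rewrite /output_elt; case: (prem C) def_vs => [|a A] def_vs.
    have O_index : index (Oelt c 0) vs = size s by rewrite def_vs index_mid // -def_vs.
    by rewrite /edges_code /= O_index.
  by have [] := chain_edges_codeE (Var a) vs_uniq def_vs; split.
rewrite /clause_edges edges_code_cat prem_code /clause_edges_code.
congr (_ ++ _); rewrite [prem _]/= -out_code.
case: (concl C) def_vs => [b|] def_vs /=; last by [].
have QC_index : index (QCelt c) vs =
    size s + (if [seq index (Var a) vs | a <- prem C] is _ :: A then (size A).*2 else 1).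
  move: vs_uniq; rewrite {1 2}def_vs catA => /index_mid ->.
  rewrite size_cat; congr (_ + _); case: (prem C) => //= a A; rewrite size_map.
  rewrite size_flatten /shape -map_comp; elim: (size A) 2 => //= k IHk j.
  by rewrite IHk.
by rewrite /edges_code /= QC_index.
Qed.

Lemma size_clause_elts (T : choiceType) c (C : clause T) :
  size (clause_elts c C) = num_elts C.
Proof.
rewrite /clause_elts /num_elts size_cat; congr (_ + _); last by case: (concl C).
case: (prem C) => // a A; rewrite size_flatten /shape -map_comp.
by elim: (size A) 2 => //= k IHk j; rewrite IHk.
Qed.

Lemma size_clause_edges (T : choiceType) c (C : clause T) :
  size (clause_edges c C) = num_edges C.
Proof.
rewrite /clause_edges /num_edges size_cat; congr (_ + _); last by case: (concl C).
case: (prem C) => // a A.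
have size_chain prev i : size (chain_edges c prev i A) = 3 * size A.
  by elim: A prev i => //= a' A IHA prev i; rewrite IHA mulnS.
exact: size_chain.
Qed.

Lemma num_elts_number (T : choiceType) (X : {fset T}) C :
  num_elts (number X C) = num_elts C.
Proof.
rewrite /num_elts /=.
by case: (prem C) (concl C) => [|a A] [b|] //=; rewrite size_map.
Qed.

Lemma num_edges_number (T : choiceType) (X : {fset T}) C :
  num_edges (number X C) = num_edges C.
Proof.
rewrite /num_edges /=.
by case: (prem C) (concl C) => [|a A] [b|] //=; rewrite size_map.
Qed.

Lemma size_elts (T : choiceType) (X : {fset T}) G :
  size (elts X G) = #|` X|.+2 + sumn (map (@num_elts T) G).
Proof.
rewrite /elts !size_cat size_map /= addnA addn2; congr (_ + _).
rewrite size_flatten /shape -map_comp /indexed.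
by elim: G 0 => //= C G IHG c; rewrite IHG size_clause_elts.
Qed.

Lemma size_construction (T : choiceType) (X : {fset T}) G :
  size (construction X G) = #|` X|.+1 + sumn (map (@num_edges T) G).
Proof.
rewrite /construction /= size_cat size_map addSn; congr (_ + _).+1.
rewrite size_flatten /shape -map_comp /indexed.
by elim: G 0 => //= C G IHG c; rewrite IHG size_clause_edges.
Qed.

Lemma index_Var (T : choiceType) (X : {fset T}) G x :
  x \in X -> index (Var x) (elts X G) = index x (enum_fset X).
Proof.
have Var_inj : injective (@Var T) by move=> ? ? [].
by move=> xX; rewrite /elts index_cat mem_map // xX index_map.
Qed.

Lemma number_index (T : choiceType) (X : {fset T}) G C :
  horn_clause X C ->
  Clause [seq index (Var a) (elts X G) | a <- prem C]
    (omap (fun b => index (Var b) (elts X G)) (concl C)) = number X C.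
Proof.
case/andP=> /allP premX conclX; congr Clause.
  by apply/eq_in_map => a /premX; apply: index_Var.
by case: (concl C) conclX => //= b /andP[bX _]; rewrite index_Var.
Qed.

Lemma cnf_edges_codeE (T : choiceType) (X : {fset T}) G D c s :
  horn_cnf X D ->
  elts X G = s ++ flatten [seq clause_elts cC.1 cC.2 | cC <- zip (iota c (size D)) D] ->
  edges_code (elts X G)
    (flatten [seq clause_edges cC.1 cC.2 | cC <- zip (iota c (size D)) D]) =
  cnf_edges_code (index Relt (elts X G)) (size s) (map (number X) D).
Proof.
elim: D c s => //= C D IHD c s /andP[CX DX] def_elts.
rewrite edges_code_cat (clause_edges_codeE (uniq_elts X G) def_elts) number_index //.
congr (_ ++ _); rewrite catA in def_elts.
by rewrite (IHD _ _ DX def_elts) size_cat size_clause_elts num_elts_number.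
Qed.

Lemma encode_construction (T : choiceType) (X : {fset T}) G :
  horn_cnf X G ->
  let D := map (number X) G in let n := #|` X| in
  encode_hypergraph (elts X G) (construction X G) =
    [:: n.+2 + sumn (map (@num_elts nat) D);
        n.+1 + sumn (map (@num_edges nat) D); 2; n; n.+1]
      ++ flatten [seq [:: 3; v; n; n.+1] | v <- iota 0 n]
      ++ cnf_edges_code n n.+2 D.
Proof.
move=> G_horn /=.
have R_index : index Relt (elts X G) = #|` X|.
  have := uniq_elts X G; rewrite {1 2}/elts => /index_mid ->.
  by rewrite size_map.
have Rho_index : index Rhoelt (elts X G) = #|` X|.+1.
  have := uniq_elts X G; rewrite {1 2}/elts.
  rewrite -[[:: Relt; Rhoelt] ++ _]/([:: Relt] ++ Rhoelt :: _) catA => /index_mid ->.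
  by rewrite size_cat size_map addn1.
rewrite /encode_hypergraph size_elts size_construction -!map_comp.
rewrite (eq_map (num_elts_number X)) (eq_map (num_edges_number X)).
congr [:: _, _ & _]; rewrite -/(edges_code _ _).
rewrite -[construction X G]/([:: [:: Relt; Rhoelt]] ++ _ ++ _) !edges_code_cat.
rewrite {1}/edges_code /= R_index Rho_index; congr [:: _, _, _ & _ ++ _].
  rewrite /edges_code -map_comp.
  rewrite -[in RHS](_ : [seq index (Var x) (elts X G) | x <- enum_fset X]
                        = iota 0 #|` X|).
    rewrite -map_comp /=; congr flatten; apply: eq_map => x /=.
    by rewrite R_index Rho_index.
  rewrite -(map_index_self (fset_uniq X)).
  by apply/eq_in_map => x xX; rewrite index_Var.
rewrite /indexed (@cnf_edges_codeE _ X G G 0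
  ([seq Var x | x <- enum_fset X] ++ [:: Relt; Rhoelt])) //.
  by rewrite R_index size_cat size_map addn2.
by rewrite -catA.
Qed.

(** * Bit vectors *)

(** Disjunction for [z = false] and, by De Morgan, conjunction for [z = true]. *)
Definition premise_value (T : Type) (z : bool) (w : pred T) (A : seq T) : bool :=
  z (+) has (fun x => w x (+) z) A.

Lemma combine_premise_value (T : Type) (z : bool) (w : pred T) A a :
  combine z (premise_value z w A) (w a) = premise_value z w (rcons A a).
Proof.
rewrite /premise_value has_rcons /combine.
by case: z (w a) (has _ A) => [] [] [].
Qed.

Lemma premise_bitE (T : Type) (z : bool) (w : pred T) (b : seq nat) (N : T -> nat) A :
  all (fun a => nth 0 b (N a) == w a) A ->
  premise_bit z b (map N A) = premise_value z w A.
Proof.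
rewrite /premise_bit; elim/last_ind: A => [|A a IHA]; first by case: z.
rewrite all_rcons => /andP[/eqP ba bA].
by rewrite !map_rcons foldl_rcons IHA // ba combine_premise_value.
Qed.

(** [A] is the part of the premise that has been evaluated. *)
Lemma chain_bitsE (T : Type) (z : bool) (w : pred T) (b : seq nat) (N : T -> nat) A A' :
  all (fun a => nth 0 b (N a) == w a) A' ->
  chain_bits z b (premise_value z w A) (map N A') =
  flatten [seq nseq 2 (premise_value z w (take i (A ++ A')) : nat)
          | i <- iota (size A).+1 (size A')].
Proof.
elim: A' A => //= a A' IHA A /andP[/eqP ba bA'].
have -> : take (size A).+1 (A ++ a :: A') = rcons A a.
  by rewrite -cat_rcons -(size_rcons A a) take_size_cat.
rewrite ba combine_premise_value IHA //= size_rcons cat_rcons.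
by [].
Qed.

Lemma clause_bitsE (T : choiceType) (X : {fset T}) (z : bool) (w : pred T)
    (b : seq nat) c (C : clause T) (q : pred (elt T)) :
  all (fun a => nth 0 b (index a (enum_fset X)) == w a) (prem C) ->
  {in clause_elts c C, forall u, q u =
     premise_value z w (if u is Oelt _ i then take i (prem C)
                        else if u is Qelt _ i then take i (prem C) else prem C)} ->
  clause_bits z b (number X C) = [seq nat_of_bool (q u) | u <- clause_elts c C].
Proof.
move=> b_w qE.
rewrite (_ : [seq _ | u <- _] = [seq nat_of_bool (premise_value z w
    (if u is Oelt _ i then take i (prem C)
     else if u is Qelt _ i then take i (prem C) else prem C))
    | u <- clause_elts c C]); last first.
  by apply/eq_in_map => u uC; rewrite qE.
rewrite /clause_bits /clause_elts map_cat /=; congr (_ ++ _); last first.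
  by case: (concl C) => //= d; rewrite (premise_bitE z b_w).
case: (prem C) b_w => [_|a A /= /andP[/eqP ba bA]] /=.
  by rewrite /premise_value /=; case: z {qE}.
rewrite ba; have := combine_premise_value z w [::] a.
rewrite {1}/premise_value /= addbF => ->; rewrite (@chain_bitsE _ z w b _ [:: a]) //=.
by rewrite map_flatten -map_comp.
Qed.

Lemma bits_elts (T : choiceType) (X : {fset T}) G (z : bool) (w : pred T)
    (b : seq nat) (K : {fset elt T}) :
  horn_cnf X G -> b = [seq nat_of_bool (w x) | x <- enum_fset X] ->
  {in X, forall x, (Var x \in K) = w x} ->
  (Relt \in K) = ~~ z -> (Rhoelt \in K) = ~~ z ->
  (forall c, c < size G -> {in clause_elts c (nth (noclause T) G c), forall u,
     (u \in K) = premise_value z w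
       (if u is Oelt _ i then take i (prem (nth (noclause T) G c))
        else if u is Qelt _ i then take i (prem (nth (noclause T) G c))
        else prem (nth (noclause T) G c))}) ->
  bits (elts X G) K =
  b ++ [:: (nat_of_bool z == 0) : nat; (nat_of_bool z == 0) : nat]
    ++ flatten (map (clause_bits z b) (map (number X) G)).
Proof.
move=> G_horn def_b KX KR KRho KG; rewrite /bits /elts !map_cat; congr (_ ++ _).
  rewrite def_b -map_comp; apply/eq_in_map => x xX /=.
  by rewrite KX.
congr (_ ++ _); first by rewrite /= KR KRho; case: z {KR KRho KG}.
rewrite (indexedE (noclause T)) -map_comp map_flatten -map_comp.
rewrite -[in RHS](mkseq_nth (noclause T) G) /mkseq -!map_comp; congr flatten.
apply/eq_in_map => c; rewrite mem_iota /= => cG; apply/esym.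
apply: clause_bitsE; last exact: KG.
have /andP[/allP premX _] := nth_horn G_horn cG.
apply/allP => a /premX /= aX.
by rewrite def_b (nth_map a) ?index_mem // nth_index.
Qed.

(** * Costs *)

Definition weight T (C : clause T) : nat := size (prem C) + isSome (concl C) + 1.

Lemma inc_lengthE (T : choiceType) (X : {fset T}) G :
  inc_length X G = #|` X| + sumn (map (@weight T) G).
Proof.
rewrite /inc_length -!addnA; congr (_ + _).
elim: G => [|C G IHG]; rewrite ?big_nil // !big_cons /= -IHG /weight.
by case: (concl C) => /=; lia.
Qed.

Lemma code_cost (T : choiceType) (X : {fset T}) G :
  size (cnf_code (map (number X) G)) <= 2 * sumn (map (@weight T) G).
Proof.
rewrite /cnf_code -map_comp; elim: G => //= C G IHG.
rewrite !size_cat size_map [weight C]/weight.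
by case: (concl C) => [b|] /=; lia.
Qed.

Lemma elts_cost (T : choiceType) (X : {fset T}) G :
  size (elts X G) <= #|` X| + 2 + 2 * sumn (map (@weight T) G).
Proof.
rewrite size_elts addn2 leq_add2l; elim: G => //= C G IHG.
rewrite mulnDr leq_add // /num_elts /weight.
by case: (prem C) (concl C) => [|a A] [b|] /=; lia.
Qed.

Lemma edges_cost (T : choiceType) (X : {fset T}) G :
  size (construction X G) <= #|` X| + 1 + 3 * sumn (map (@weight T) G).
Proof.
rewrite size_construction addn1 leq_add2l; elim: G => //= C G IHG.
rewrite mulnDr leq_add // /num_edges /weight.
by case: (prem C) (concl C) => [|a A] [b|] /=; lia.
Qed.

Lemma hlength_cost (T : choiceType) (X : {fset T}) G :
  hlength (U X G) (construction X G) <= 200 * (inc_length X G).+1.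
Proof.
rewrite /hlength inc_lengthE.
have U_le : #|` U X G| <= size (elts X G).
  by apply: uniq_leq_size => [|u]; rewrite ?fset_uniq // -mem_U.
have sum_le : \sum_(e <- construction X G) size e <= 3 * size (construction X G).
  elim: (construction X G) (construction_edge_size X G) => [|e H IHH].
    by rewrite big_nil.
  by rewrite big_cons /= => /andP[/andP[_ e3] /IHH]; lia.
move: U_le sum_le (elts_cost X G) (edges_cost X G).
set v := #|` U X G|; set n := size (elts _ _); set h := size (construction _ _).
by set m := \sum_(_ <- _) _; lia.
Qed.

Lemma construction_rank (T : choiceType) (X : {fset T}) G :
  hrank (construction X G) <= 3.
Proof.
by apply/bigmax_leqP_seq => e /(allP (construction_edge_size X G))/andP[].
Qed.

Lemma computes_le p i o t t' : computes p i o t -> t <= t' -> computes p i o t'.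
Proof. by case=> s [u [pu def_o ut]] tt'; exists s, u; split=> //; lia. Qed.

Lemma computes_build (T : choiceType) (X : {fset T}) G :
  horn_cnf X G ->
  computes build (encode_cnf X G) (encode_hypergraph (elts X G) (construction X G))
    (200 * (inc_length X G).+1).
Proof.
move=> G_horn; rewrite encode_cnfE encode_construction //.
have [c' [run_build out]] := runs_build #|` X| (map (number X) G).
apply: computes_le (runs_computes run_build out) _.
by rewrite inc_lengthE; have := code_cost X G; lia.
Qed.

Lemma computes_forward (T : choiceType) (X S : {fset T}) G (z : bool) (K : {fset elt T}) :
  bits (elts X G) K =
    bits (enum_fset X) S ++ [:: (nat_of_bool z == 0) : nat; (nat_of_bool z == 0) : nat]
      ++ flatten (map (clause_bits z (bits (enum_fset X) S)) (map (number X) G)) ->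
  computes (forward z) (encode_cnf X G ++ bits (enum_fset X) S) (bits (elts X G) K)
    (200 * (inc_length X G).+1).
Proof.
move=> ->; rewrite encode_cnfE.
have [|c' [run_fwd out]] :=
  @runs_forward z #|` X| (map (number X) G) (bits (enum_fset X) S).
  by rewrite size_map.
apply: computes_le (runs_computes run_fwd out) _.
by rewrite inc_lengthE; have := code_cost X G; lia.
Qed.

Lemma computes_backward (T : choiceType) (X : {fset T}) G (K : {fset elt T}) :
  computes backward (encode_cnf X G ++ bits (elts X G) K)
    (bits (enum_fset X) (trace X K)) (200 * (inc_length X G).+1).
Proof.
have -> : bits (elts X G) K = bits (enum_fset X) (trace X K) ++
    [seq nat_of_bool (u \in K) | u <- [:: Relt; Rhoelt] ++
       flatten [seq clause_elts cC.1 cC.2 | cC <- indexed G]].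
  rewrite /bits /elts map_cat; congr (_ ++ _); rewrite -map_comp.
  by apply/eq_in_map => x xX; rewrite /= mem_trace xX.
rewrite encode_cnfE.
have [|c' [run_bwd out]] := @runs_backward #|` X| (map (number X) G)
    (bits (enum_fset X) (trace X K))
    [seq nat_of_bool (u \in K) | u <- [:: Relt; Rhoelt] ++
       flatten [seq clause_elts cC.1 cC.2 | cC <- indexed G]].
  by rewrite size_map.
apply: computes_le (runs_computes run_bwd out) _.
by rewrite inc_lengthE; have := code_cost X G; lia.
Qed.

Local Open Scope fset_scope.

Lemma computes_eta (T : choiceType) (X S : {fset T}) G :
  horn_cnf X G -> S \in False_ X G ->
  computes (forward false) (encode_cnf X G ++ bits (enum_fset X) S)
    (bits (elts X G) (eta_map X G S)) (200 * (inc_length X G).+1).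
Proof.
move=> G_horn SF; apply: computes_forward.
apply: (@bits_elts _ _ _ false (mem S)) => //.
- by move=> x xX; rewrite mem_eta mem_elts xX.
- by rewrite mem_eta mem_elts.
- by rewrite mem_eta mem_elts.
move=> c cG u uC; have uc := owner_clause_elts uC.
rewrite mem_eta (in_eta_gate _ _ uc) mem_elts /premise_value.
by case: u uc uC => // [? i|? i|?] [->] /= ->; rewrite cG /=;
   apply: eq_has => a; rewrite addbF.
Qed.

Lemma computes_etahat (T : choiceType) (X M : {fset T}) G :
  horn_cnf X G -> M \in Mod X G ->
  computes (forward true) (encode_cnf X G ++ bits (enum_fset X) M)
    (bits (elts X G) (etahat_map X G M)) (200 * (inc_length X G).+1).
Proof.
move=> G_horn MG; apply: computes_forward.
have mem_etahat u : (u \in etahat_map X G M) =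
    (u \in elts X G) && ~~ in_eta G (X `\` M) u.
  by rewrite in_fsetD mem_eta mem_U; case: (u \in _); rewrite ?andbT.
apply: (@bits_elts _ _ _ true (mem M)) => //.
- by move=> x xX; rewrite mem_etahat mem_elts xX /= in_fsetD xX andbT negbK.
- by rewrite mem_etahat mem_elts.
- by rewrite mem_etahat mem_elts.
move=> c cG u uC; have uc := owner_clause_elts uC.
rewrite mem_etahat (in_eta_gate _ _ uc) mem_elts /premise_value.
have /andP[/allP premX _] := nth_horn G_horn cG.
have outside a : a \in prem (nth (noclause T) G c) ->
    (a \in X `\` M) = (a \in M) (+) true.
  by move=> /premX /= aX; rewrite in_fsetD aX andbT addbT.
case: u uc uC => // [? i|? i|?] [->] /= ->; rewrite cG /=; congr (~~ _);
  apply: eq_in_has => a; try exact: outside.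
  by move=> /mem_take; apply: outside.
by move=> /mem_take; apply: outside.
Qed.

Theorem theorem3p11 :
  exists (c : nat) (build fwd_eta fwd_etahat inv_eta inv_etahat : com),
  forall (T : choiceType) (X : {fset T}) (G : cnf T),
    horn_cnf X G -> normalized_cnf G ->
    let UG := U X G in
    let CG := construction X G in
    let bound := c * (inc_length X G).+1 in
    (* the hypergraph C(Gamma) *)
    [/\ computes build (encode_cnf X G) (encode_hypergraph (elts X G) CG) bound,
        uniq (elts X G) /\ hypergraph_on UG CG,
        normalized_hypergraph CG,
        hrank CG <= 3
      & hlength UG CG <= bound]
    /\
    (* the isomorphisms and their inverses *)
    [/\ incl_iso (False_ X G) (Stop UG CG `\ fset0) (eta_map X G) (trace X),
        incl_iso (Mod X G) (proper_models UG CG) (etahat_map X G) (trace X),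
        {in Mod X G, forall M,
           unique (fun K => K \in proper_models UG CG /\ trace X K = M)
                  (etahat_map X G M)},
        {in Mod X G, forall M,
           {in proper_models UG CG &, forall K K',
              trace X K = M -> trace X K' = M ->
              {in UG `\` [fset Var x | x in X], K =i K'}}}
      & bij_between (incl_max (Mod X G)) (coatoms UG CG) (etahat_map X G)]
    /\
    (* evaluation on bit vectors *)
    [/\ {in False_ X G, forall S,
           computes fwd_eta
             (encode_cnf X G ++ bits (enum_fset X) S)
             (bits (elts X G) (eta_map X G S)) bound},
        {in Mod X G, forall M,
           computes fwd_etahat
             (encode_cnf X G ++ bits (enum_fset X) M)
             (bits (elts X G) (etahat_map X G M)) bound},
        {in Stop UG CG `\ fset0, forall S,
           computes inv_eta
             (encode_cnf X G ++ bits (elts X G) S)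
             (bits (enum_fset X) (trace X S)) bound}
      & {in proper_models UG CG, forall K,
           computes inv_etahat
             (encode_cnf X G ++ bits (elts X G) K)
             (bits (enum_fset X) (trace X K)) bound}].
Proof.
(* [runs_build] takes 90 steps per entry of the code of the clauses, and
   [code_cost] allows 2 entries per unit of weight; 200 also covers the rest. *)
exists 200, build, (forward false), (forward true), backward, backward.
move=> T X G G_horn G_norm UG CG bound.
have CG_uniq : all uniq CG by apply: construction_uniq => //; case/andP: G_norm.
have CG_on : hypergraph_on UG CG by apply: construction_on.
have hat_iso := etahat_iso G_horn CG_uniq CG_on.
have [hatP _ hatK traceK _] := hat_iso.
split; [|split].
- split.
  + exact: computes_build.
  + by split; first exact: uniq_elts.
  + apply/and3P; split=> //; first exact: construction_distinct.
    by apply/negP => /(allP (construction_edge_size X G)).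
  + exact: construction_rank.
  + exact: hlength_cost.
- split.
  + exact: eta_iso.
  + exact: hat_iso.
  + move=> M MG; split; first by split; [exact: hatP | exact: hatK].
    by move=> K [KP <-]; rewrite traceK.
  + move=> M _ K K' KP KP' KM K'M u _.
    by rewrite -(traceK _ KP) -(traceK _ KP') KM K'M.
  + exact: incl_iso_max hat_iso.
- split.
  + by move=> S; apply: computes_eta.
  + by move=> M; apply: computes_etahat.
  + by move=> R _; apply: computes_backward.
  + by move=> K _; apply: computes_backward.
Qed.
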